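(* Suppose there is a $\delta$-approximation for number balancing with error parameter $\delta=\frac{\rho(n)}{2^n}$, where $\rho(n)\le 2^{n/2}$. Then there is a polynomial time algorithm that on input $\mathbf{a}_1,\dots,\mathbf{a}_n\in[0,1]^n$ and $0<\lambda_1\le\dots\le\lambda_n\le 2^n$ with $\prod_{i=1}^n\lambda_i\ge1$ finds a vector $\mathbf{x}\in\mathbb{Z}^n\setminus\{\mathbf{0}\}$ with $|\langle\mathbf{x},\mathbf{a}_i\rangle|\le O(n^4)\cdot\lambda_i\cdot\rho(4n^2)^{1/n}$ for all $i=1,\dots,n$.
   Context: For a function $\delta(n)>0$, a $\delta$-approximation for number balancing is a polynomial time algorithm that receives $\mathbf{a}\in[0,1]^n$ (for any $n$) as input and produces a vector $\mathbf{x}\in\{-1,0,1\}^n\setminus\{\mathbf{0}\}$ with $|\langle\mathbf{a},\mathbf{x}\rangle|\le\delta(n)$. *)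

(* Defs.v *)
From HB Require Import structures.
From mathcomp Require Import all_boot all_order all_algebra.
From mathcomp Require Import all_reals exp.

Set Implicit Arguments.
Unset Strict Implicit.
Unset Printing Implicit Defensive.

Import Order.TTheory GRing.Theory Num.Theory.

(** A deterministic while-language over binary trees with integer leaves, under
  the logarithmic (bit) cost criterion: every elementary step is charged the
  full bit-size of the data it reads and of the data it writes.  Hence no value
  produced during a run is larger than its running time ([run_size]), and since
  each elementary operation is computable by a Turing machine in time polynomial
  in these bit-sizes, polynomial time here is the usual polynomial time. *)

Inductive data : Type :=
| Leaf of int
| Node of data & data.

Fixpoint dsize (d : data) : nat :=
  match d with
  | Leaf z => (trunc_log 2 `|z|%N).+1
  | Node d1 d2 => (dsize d1 + dsize d2).+1
  end.

Inductive prim : Type :=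
| Id | Const of data | Fst | Snd | Add | Sub | Mul | Div | Le.

(* Arithmetic acts on pairs of numbers; ill-typed arguments yield [Leaf 0].
   [Div] is Euclidean division, with quotient 0 when the divisor is 0. *)
Definition arith (op : int -> int -> int) (d : data) : data :=
  if d is Node (Leaf x) (Leaf y) then Leaf (op x y) else Leaf 0.

Definition prim_eval (o : prim) (d : data) : data :=
  match o with
  | Id => d
  | Const e => e
  | Fst => if d is Node d1 _ then d1 else Leaf 0
  | Snd => if d is Node _ d2 then d2 else Leaf 0
  | Add => arith (fun x y => x + y)%R d
  | Sub => arith (fun x y => x - y)%R d
  | Mul => arith (fun x y => x * y)%R d
  | Div => arith divz d
  | Le => arith (fun x y => Posz (x <= y)%R) d
  end.

Inductive prog : Type :=
| Prim of prim
| Seq of prog & prog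
| Fork of prog & prog
| Cond of prog & prog & prog
| While of prog & prog.

Definition truth (d : data) : bool := if d is Leaf z then z != 0%R else true.

(* [run p d e t]: on input [d], the program [p] halts with output [e] after
   time [t]. *)
Inductive run : prog -> data -> data -> nat -> Prop :=
| RunPrim o d :
    run (Prim o) d (prim_eval o d) (dsize d + dsize (prim_eval o d))
| RunSeq f g d e r t u :
    run f d e t -> run g e r u -> run (Seq f g) d r (t + u)
| RunFork f g d e r t u :
    run f d e t -> run g d r u ->
    run (Fork f g) d (Node e r) (dsize d + dsize (Node e r) + t + u)
| RunCondTrue c f g d b e t u :
    run c d b t -> truth b -> run f d e u ->
    run (Cond c f g) d e (dsize d + t + u)
| RunCondFalse c f g d b e t u :
    run c d b t -> ~~ truth b -> run g d e u ->
    run (Cond c f g) d e (dsize d + t + u)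
| RunWhileTrue c f d b e r t u v :
    run c d b t -> truth b -> run f d e u -> run (While c f) e r v ->
    run (While c f) d r (dsize d + t + u + v)
| RunWhileFalse c f d b t :
    run c d b t -> ~~ truth b -> run (While c f) d d (dsize d + t).

Lemma run_deterministic p d e1 e2 t1 t2 :
  run p d e1 t1 -> run p d e2 t2 -> e1 = e2 /\ t1 = t2.
Proof.
move=> H; elim: H e2 t2 => {p d e1 t1}; intros;
  repeat match goal with
    IH : forall e t, run ?p ?d e t -> (?e0 = e) /\ (?t0 = t),
    K : run ?p ?d ?e0 ?t0 |- _ => clear K
  end;
  match goal with
    H : run _ _ ?x ?y |- (_ = ?x) /\ (_ = ?y) => inversion H; subst
  end;
  repeat match goal with
    IH : forall e t, run ?p ?d e t -> _, K : run ?p ?d ?e ?t |- _ =>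
      let h1 := fresh in let h2 := fresh in
      destruct (IH e t K) as [h1 h2]; clear IH K; subst
  end; try by split.
all: by match goal with
    h : is_true (truth ?b), k : is_true (~~ truth ?b) |- _ => rewrite h in k
  end.
Qed.

Lemma run_size p d e t : run p d e t -> dsize d + dsize e <= t.
Proof.
elim=> {p d e t} //.
- move=> f g d e r t u _ Hf _ Hg; apply: leq_add.
  + exact: leq_trans (leq_addr _ _) Hf.
  + exact: leq_trans (leq_addl _ _) Hg.
- by move=> *; rewrite -addnA leq_addr.
- move=> c f g d b e t u _ _ _ _ Hf.
  exact: leq_trans Hf (leq_addl _ _).
- move=> c f g d b e t u _ _ _ _ Hf.
  exact: leq_trans Hf (leq_addl _ _).
- move=> c f d b e r t u v _ _ _ _ _ _ Hw; apply: leq_add.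
  + by rewrite -addnA leq_addr.
  + exact: leq_trans (leq_addl _ _) Hw.
- by move=> c f d b t _ Hc _; rewrite leq_add2l; exact: leq_trans (leq_addr _ _) Hc.
Qed.

Definition enc_seq (s : seq data) : data := foldr Node (Leaf 0) s.

Definition enc_rat (q : rat) : data := Node (Leaf (numq q)) (Leaf (denq q)).

Definition enc_rVint n (v : 'rV[int]_n) : data :=
  enc_seq [seq Leaf (v ord0 j) | j <- enum 'I_n].

Definition enc_rVrat n (v : 'rV[rat]_n) : data :=
  enc_seq [seq enc_rat (v ord0 j) | j <- enum 'I_n].

Definition enc_mxrat m n (A : 'M[rat]_(m, n)) : data :=
  enc_seq [seq enc_rVrat (row i A) | i <- enum 'I_m].

(** A single program, running in time polynomial in the bit-size of the input,
  that for every dimension [n >= 1] and every instance [x : I n] satisfying the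
  promise [pre] outputs (the encoding of) some [y : O n] with [post x y].
  Bit-sizes are positive, so a time bound is polynomial if and only if it is
  dominated by some [c * s ^ k].  Dimension 0 is excluded because the outputs
  sought below are nonzero vectors. *)
Definition poly_time_solvable (I O : nat -> Type)
    (encI : forall n, I n -> data) (encO : forall n, O n -> data)
    (pre : forall n, I n -> Prop) (post : forall n, I n -> O n -> Prop) : Prop :=
  exists (p : prog) (c k : nat), forall (n : nat) (x : I n),
    0 < n -> pre n x ->
    exists (y : O n) (t : nat),
      [/\ run p (encI n x) (encO n y) t,
          t <= c * dsize (encI n x) ^ k
        & post n x y].

Local Open Scope ring_scope.

Definition dot n (x : 'rV[int]_n) (a : 'rV[rat]_n) : rat :=
  \sum_(j < n) (x ord0 j)%:~R * a ord0 j.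

(** The entries of [a] are rationals, given in binary; the error bound [delta]
  is real-valued and need not be computable.  In dimension 1 the instance
  [a = (1)] forces [1 <= delta 1]; hence a growth condition such as
  [rho n <= 2 `^ (n / 2)] on [rho n = delta n * 2 ^ n] is only consistent when
  imposed for [2 <= n]. *)
Definition number_balancing_approximation (R : realType) (delta : nat -> R) :
    Prop :=
  (forall n : nat, (0 < n)%N -> 0 < delta n) /\
  poly_time_solvable enc_rVrat enc_rVint
    (fun n (a : 'rV[rat]_n) => forall j, 0 <= a ord0 j <= 1)
    (fun n (a : 'rV[rat]_n) (x : 'rV[int]_n) =>
      [/\ forall j, x ord0 j \in [:: -1; 0; 1],
          x != 0
        & `|ratr (dot x a)| <= delta n]).

(* Main.v *)
Require Import Defs.
From HB Require Import structures.
From mathcomp Require Import all_boot all_order all_algebra.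
From mathcomp Require Import all_reals exp boolp.
From mathcomp Require Import zify ring lra.

(** The linear forms are rounded and packed into a single number balancing
  instance.  Write [x_j = sum_l 2^l z_{j,l}] with [l < 4 n] and
  [z_{j,l} in {-1, 0, 1}], so that there are [N = 4 n^2] signs, and [z <> 0]
  forces [x <> 0] by parity.  For a guess [2^s] of [rho(N)^(1/n)] (up to a
  constant) put [mu_i = lambda_i n 2^s], [B_{i,(j,l)} = floor (2^l a_ij / mu_i)]
  and [T_i = floor (2^(4n) / (lambda_i 2^s))], which bounds [sum_k B_{i,k}].
  Rounding each [2^l a_ij] separately costs only [N mu_i] in total, hence it
  suffices that [sum_k z_k B_{i,k} = 0] for all [i].  As [|sum_k z_k B_{i,k}| <= T_i],
  these [n] equations are equivalent to a single one [sum_k z_k W_k = 0], where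
  the [W_k] are mixed-radix numbers with digits [B_{i,k}] and bases [T_i + 1].
  Since [prod_i lambda_i >= 1], the modulus [D = prod_i (T_i + 1)] is at most
  [(3/4)^n 2^N / rho(N)] as soon as [2^(s n) >= 4^n rho(N)]; the oracle applied
  to [W_k / D] then makes the integer [sum_k z_k W_k] smaller than [1] in absolute
  value.  As [rho] is not computable, the algorithm takes the first [s] for which
  the equation holds; it is at most [2 n + 2] because [rho(N) <= 2^(N/2)]. *)

Set Implicit Arguments.
Unset Strict Implicit.
Unset Printing Implicit Defensive.

Import Order.TTheory GRing.Theory Num.Theory.

(** * Polynomial time maps between encodings *)

Definition pbound (X : Type) (P : X -> Prop) (e : X -> data) (f : X -> nat) :=
  exists c k, forall x, P x -> f x <= c * dsize (e x) ^ k.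

(* One program maps [e x] to [f x] for all [x] satisfying [P], in time polynomial
  in the size of [e x]: both [e] and [f] are regarded as encodings of [x]. *)
Definition ptime (X : Type) (P : X -> Prop) (e f : X -> data) :=
  exists p T, pbound P e T /\
    forall x, P x -> exists2 t, run p (e x) (f x) t & t <= T x.

Lemma dsize_gt0 d : 0 < dsize d.
Proof. by case: d. Qed.

Lemma leq_wexp2r m n k : m <= n -> m ^ k <= n ^ k.
Proof. by case: k => // k le_mn; rewrite leq_exp2r. Qed.

(** * Calculus of polynomial bounds *)

Section Bounds.
Variables (X : Type) (P : X -> Prop).
Implicit Types (e : X -> data) (f g : X -> nat).

Lemma pb_le e f g : (forall x, P x -> f x <= g x) -> pbound P e g -> pbound P e f.
Proof. by move=> H [c [k K]]; exists c, k => x Px; exact: leq_trans (H x Px) (K x Px). Qed.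

Lemma pb_const e c : pbound P e (fun=> c).
Proof. by exists c, 0 => x _; rewrite expn0 muln1. Qed.

Lemma pb_size e : pbound P e (fun x => dsize (e x)).
Proof. by exists 1, 1 => x _; rewrite mul1n expn1. Qed.

Lemma pb_add e f g : pbound P e f -> pbound P e g -> pbound P e (fun x => f x + g x).
Proof.
move=> [c [k K]] [c' [k' K']]; exists (c + c'), (maxn k k') => x Px.
rewrite mulnDl leq_add //.
- by apply: leq_trans (K x Px) _; rewrite leq_mul2l leq_pexp2l ?dsize_gt0 ?leq_maxl ?orbT.
- by apply: leq_trans (K' x Px) _; rewrite leq_mul2l leq_pexp2l ?dsize_gt0 ?leq_maxr ?orbT.
Qed.

Lemma pb_mul e f g : pbound P e f -> pbound P e g -> pbound P e (fun x => f x * g x).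
Proof.
move=> [c [k K]] [c' [k' K']]; exists (c * c'), (k + k') => x Px.
by rewrite expnD mulnACA leq_mul ?K ?K'.
Qed.

Lemma pb_exp e f k : pbound P e f -> pbound P e (fun x => f x ^ k).
Proof.
move=> H; elim: k => [|k IH]; first exact: (pb_const e 1).
by apply: pb_le (pb_mul H IH) => x _; rewrite expnS.
Qed.

Lemma pb_trans e e' f :
  pbound P e (fun x => dsize (e' x)) -> pbound P e' f -> pbound P e f.
Proof.
move=> H [c [k K]]; apply: pb_le K _.
exact: pb_mul (pb_const _ c) (pb_exp k H).
Qed.

(** A result is never larger than the time spent on producing it, so composition of polynomial time
    maps needs no separate hypothesis on intermediate sizes. *)
Lemma ptime_pb e e' : ptime P e e' -> pbound P e (fun x => dsize (e' x)).
Proof.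
move=> [p [T [HT H]]]; apply: pb_le HT => x /H [t /run_size Ht le_t].
exact: leq_trans (leq_trans (leq_addl _ _) Ht) le_t.
Qed.

End Bounds.

(** This and [pt_reindex] specialise a family of inputs, for instance to forget a loop counter or to
    call the oracle on a computed instance. *)
Lemma pb_reindex X Y (P : X -> Prop) (Q : Y -> Prop) (h : Y -> X) e f :
  (forall y, Q y -> P (h y)) ->
  pbound P e f -> pbound Q (fun y => e (h y)) (fun y => f (h y)).
Proof. by move=> QP [c [k K]]; exists c, k => y /QP /K. Qed.

Lemma pt_reindex X Y (P : X -> Prop) (Q : Y -> Prop) (h : Y -> X) e f :
  (forall y, Q y -> P (h y)) ->
  ptime P e f -> ptime Q (fun y => e (h y)) (fun y => f (h y)).
Proof.
move=> QP [p [T [HT H]]]; exists p, (fun y => T (h y)); split.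
- exact: (pb_reindex QP HT).
- by move=> y /QP /H.
Qed.

(** * Closure of polynomial time under composition, pairing and projection *)

Section Combinators.
Variables (X : Type) (P : X -> Prop).
Implicit Types (e f g : X -> data).

Lemma pt_ext e f g : (forall x, P x -> f x = g x) -> ptime P e f -> ptime P e g.
Proof.
by move=> E [p [T [HT H]]]; exists p, T; split => // x Px; rewrite -E //; exact: H.
Qed.

Lemma pt_trans e f g : ptime P e f -> ptime P f g -> ptime P e g.
Proof.
move=> ef; have Hs := ptime_pb ef; case: ef => p [T [HT H]] [q [U [HU K]]].
exists (Seq p q), (fun x => T x + U x); split.
- exact: pb_add HT (pb_trans Hs HU).
- move=> x Px; have [t Ht lt] := H x Px; have [u Hu lu] := K x Px.
  by exists (t + u); [exact: RunSeq Ht Hu | exact: leq_add].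
Qed.

Lemma pt_prim o e f :
  (forall x, P x -> prim_eval o (e x) = f x) ->
  pbound P e (fun x => dsize (f x)) -> ptime P e f.
Proof.
move=> E H; exists (Prim o), (fun x => dsize (e x) + dsize (f x)); split.
- exact: pb_add (pb_size P e) H.
- move=> x Px; exists (dsize (e x) + dsize (f x)) => //.
  by rewrite -E //; exact: RunPrim.
Qed.

Lemma pt_refl e : ptime P e e.
Proof. by apply: (pt_prim (o := Id)) => //; exact: pb_size. Qed.

Lemma pt_const e d : ptime P e (fun=> d).
Proof. by apply: (pt_prim (o := Const d)) => //; exact: pb_const. Qed.

Lemma pt_pair e f g :
  ptime P e f -> ptime P e g -> ptime P e (fun x => Node (f x) (g x)).
Proof.
move=> ef eg; have Hf := ptime_pb ef; have Hg := ptime_pb eg.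
case: ef => p [T [HT H]]; case: eg => q [U [HU K]].
exists (Fork p q),
  (fun x => dsize (e x) + (1 + (dsize (f x) + dsize (g x))) + T x + U x); split.
- apply: pb_add HU; apply: pb_add HT; apply: pb_add; first exact: pb_size.
  by apply: pb_add; [exact: pb_const | exact: pb_add].
- move=> x Px; have [t Ht lt] := H x Px; have [u Hu lu] := K x Px.
  eexists; first exact: RunFork Ht Hu.
  by rewrite !leq_add.
Qed.

Lemma pt_proj1 f g : ptime P (fun x => Node (f x) (g x)) f.
Proof.
apply: (pt_prim (o := Fst)) => //.
by apply: pb_le (pb_size P _) => x _ /=; rewrite leqW // leq_addr.
Qed.

Lemma pt_proj2 f g : ptime P (fun x => Node (f x) (g x)) g.
Proof.
apply: (pt_prim (o := Snd)) => //.
by apply: pb_le (pb_size P _) => x _ /=; rewrite leqW // leq_addl.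
Qed.

Lemma pt_fst e f g : ptime P e (fun x => Node (f x) (g x)) -> ptime P e f.
Proof. by move/pt_trans; apply; exact: pt_proj1. Qed.

Lemma pt_snd e f g : ptime P e (fun x => Node (f x) (g x)) -> ptime P e g.
Proof. by move/pt_trans; apply; exact: pt_proj2. Qed.

Lemma pt_ctx1 e e' f : ptime P e f -> ptime P (fun x => Node (e x) (e' x)) f.
Proof. exact/pt_trans/pt_proj1. Qed.

End Combinators.

(** * Bit-sizes of integers and arithmetic *)

Lemma dsize_leaf_le z b : (`|z| < 2 ^ b)%N -> dsize (Leaf z) <= b.+1.
Proof.
(* [Leaf 0] has size 1, so the successor in the bound is what covers [b = 0]. *)
rewrite /= ltnS => ltz; case: (posnP `|z|%N) => [->|z0]; first by rewrite trunc_log0.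
case/andP: (trunc_log_bounds (p := 2) isT z0) => le _.
by rewrite -(leq_exp2l (m := 2)) // (leq_trans le) // ltnW.
Qed.

Lemma ltn_dsize_leaf z : `|z| < 2 ^ dsize (Leaf z).
Proof.
case: (posnP `|z|%N) => [->|z0]; first by rewrite expn_gt0.
by case/andP: (trunc_log_bounds (p := 2) isT z0).
Qed.

Lemma dsize_leaf_mono y z : `|y| <= `|z| -> dsize (Leaf y) <= dsize (Leaf z).
Proof. by move=> le; rewrite /= ltnS leq_trunc_log. Qed.

Lemma dsize_leafD y z : dsize (Leaf (y + z)%R) <= (dsize (Leaf y) + dsize (Leaf z)).+1.
Proof.
set a := dsize (Leaf y); set b := dsize (Leaf z).
apply: (@leq_trans (maxn a b).+2).
  apply: dsize_leaf_le.
  have Hy : `|y| < 2 ^ a := ltn_dsize_leaf y.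
  have Hz : `|z| < 2 ^ b := ltn_dsize_leaf z.
  have la : 2 ^ a <= 2 ^ maxn a b by rewrite leq_exp2l // leq_maxl.
  have lb : 2 ^ b <= 2 ^ maxn a b by rewrite leq_exp2l // leq_maxr.
  rewrite expnS; lia.
have a0 : 0 < a := dsize_gt0 _; have b0 : 0 < b := dsize_gt0 _; lia.
Qed.

Lemma dsize_leafM y z : dsize (Leaf (y * z)%R) <= (dsize (Leaf y) + dsize (Leaf z)).+1.
Proof. by apply: dsize_leaf_le; rewrite abszM expnD ltn_mul ?ltn_dsize_leaf. Qed.

Section Arithmetic.
Variables (X : Type) (P : X -> Prop) (e : X -> data).
Implicit Types (a b : X -> int).

(** The growth allowed for [op] is exactly the size of the pair that the primitive reads, so writing
    the result costs no more than reading the arguments. *)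
Lemma pt_arith o op a b :
  (forall d, prim_eval o d = arith op d) ->
  (forall y z, dsize (Leaf (op y z)) <= (dsize (Leaf y) + dsize (Leaf z)).+1) ->
  ptime P e (fun x => Leaf (a x)) -> ptime P e (fun x => Leaf (b x)) ->
  ptime P e (fun x => Leaf (op (a x) (b x))).
Proof.
move=> E S Ha Hb; apply: pt_trans (pt_pair Ha Hb) _.
apply: (pt_prim (o := o)) => [x _|]; first by rewrite E.
by apply: pb_le (pb_size P _) => x _; exact: S.
Qed.

Lemma pt_add a b :
  ptime P e (fun x => Leaf (a x)) -> ptime P e (fun x => Leaf (b x)) ->
  ptime P e (fun x => Leaf (a x + b x)%R).
Proof. by apply: (pt_arith (o := Defs.Add)) => //; exact: dsize_leafD. Qed.

Lemma pt_sub a b :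
  ptime P e (fun x => Leaf (a x)) -> ptime P e (fun x => Leaf (b x)) ->
  ptime P e (fun x => Leaf (a x - b x)%R).
Proof.
move=> Ha Hb; apply: (pt_arith (o := Defs.Sub) (op := fun y z => y - z)%R _ _ _ _ Ha Hb) => // y z.
apply: leq_trans (dsize_leafD _ _) _.
by rewrite ltnS leq_add2l dsize_leaf_mono // abszN.
Qed.

Lemma pt_mul a b :
  ptime P e (fun x => Leaf (a x)) -> ptime P e (fun x => Leaf (b x)) ->
  ptime P e (fun x => Leaf (a x * b x)%R).
Proof. by apply: (pt_arith (o := Defs.Mul)) => //; exact: dsize_leafM. Qed.

Lemma pt_div a b :
  ptime P e (fun x => Leaf (a x)) -> ptime P e (fun x => Leaf (b x)) ->
  ptime P e (fun x => Leaf (a x %/ b x)%Z).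
Proof.
move=> Ha Hb; apply: (pt_arith (o := Defs.Div) (op := divz) _ _ Ha Hb) => // y z.
apply: leq_trans (leq_trans (leq_addr (dsize (Leaf z)) _) (leqnSn _)).
apply: dsize_leaf_mono.
(* For [y = Negz n] the quotient is, up to sign, [Negz] of [n] divided by [|z|]: rounding away from
   zero still does not exceed [|y|]. *)
by case: y => n; rewrite /divz abszM; case: (sgzP z) => _; rewrite ?mul0n ?mul1n /= ?ltnS ?leq_div.
Qed.

Lemma pt_le a b :
  ptime P e (fun x => Leaf (a x)) -> ptime P e (fun x => Leaf (b x)) ->
  ptime P e (fun x => Leaf (Posz (a x <= b x)%R)).
Proof.
move=> Ha Hb.
apply: (pt_arith (o := Defs.Le) (op := fun y z => Posz (y <= z)%R) _ _ Ha Hb) => // y z.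
case: (y <= z)%R; rewrite /= ?trunc_log1 ?trunc_log0; lia.
Qed.
End Arithmetic.

(** * Loops and recursion schemes *)

Section Loops.
Variables (X : Type) (P : X -> Prop).

(** Iterating a polynomial time body polynomially often may square the data in each round. Hence all
    states are required to be of polynomial size in the initial one; then every round has the same
    polynomial cost bound. *)
Lemma pt_while (st : X -> nat -> data) (N : X -> nat) (b : X * nat -> data) :
  (forall x i, P x -> i <= N x -> truth (b (x, i)) = (i < N x)) ->
  ptime (fun y : X * nat => P y.1 /\ y.2 <= N y.1) (fun y => st y.1 y.2) b ->
  ptime (fun y : X * nat => P y.1 /\ y.2 < N y.1)
    (fun y => st y.1 y.2) (fun y => st y.1 y.2.+1) ->
  pbound (fun y : X * nat => P y.1 /\ y.2 <= N y.1)
    (fun y => st y.1 0) (fun y => dsize (st y.1 y.2)) ->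
  pbound P (fun x => st x 0) N ->
  ptime P (fun x => st x 0) (fun x => st x (N x)).
Proof.
move=> Hb [p [T [[c1 [k1 HT]] H]]] [q [U [[c2 [k2 HU]] K]]] [c [k HS]] HN.
(* [S x] bounds every state, and [B x] the cost of one round: reading the state, guard and body. The
   failing last test is the additional round in [(N x).+1]. *)
pose S x := c * dsize (st x 0) ^ k.
pose B x := S x + c1 * S x ^ k1 + c2 * S x ^ k2.
have pS : pbound P (fun x => st x 0) S by exists c, k.
exists (While p q), (fun x => (N x).+1 * B x); split.
  apply: pb_mul; first by apply: pb_le (pb_add HN (pb_const _ _ 1)) => x _; rewrite addn1.
  by apply: pb_add; [apply: (pb_add pS)|]; apply: pb_mul; (exact: pb_const || exact: (pb_exp _ pS)).
move=> x Px.
(* Induction on the number [m] of remaining rounds. *)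
suff L m i : i + m = N x ->
    exists2 t, run (While p q) (st x i) (st x (N x)) t & t <= m.+1 * B x.
  exact: (L (N x) 0).
elim: m i => [|m IH] i.
  rewrite addn0 => iN; have [t Ht lt] := H (x, i) (conj Px (eq_leq iN)).
  have Sx : dsize (st x i) <= S x by exact: (HS (x, i) (conj Px (eq_leq iN))).
  rewrite -iN; eexists; first by apply: RunWhileFalse Ht _; rewrite Hb // iN ?ltnn.
  rewrite mul1n (leq_trans _ (leq_addr _ _)) // leq_add //.
  apply: leq_trans lt (leq_trans (HT (x, i) (conj Px (eq_leq iN))) _) => /=.
  by rewrite leq_mul2l leq_wexp2r ?orbT.
move=> iN; have lt_iN : i < N x by lia.
have [t Ht lt] := H (x, i) (conj Px (ltnW lt_iN)).
have [u Hu lu] := K (x, i) (conj Px lt_iN).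
have [v Hv lv] := IH i.+1 (etrans (addSnnS _ _) iN).
have Sx : dsize (st x i) <= S x by exact: (HS (x, i) (conj Px (ltnW lt_iN))).
eexists; first by apply: RunWhileTrue Ht _ Hu Hv; rewrite Hb // ltnW.
rewrite mulSn leq_add // !leq_add //.
  apply: leq_trans lt (leq_trans (HT (x, i) (conj Px (ltnW lt_iN))) _) => /=.
  by rewrite leq_mul2l leq_wexp2r ?orbT.
apply: leq_trans lu (leq_trans (HU (x, i) (conj Px lt_iN)) _) => /=.
by rewrite leq_mul2l leq_wexp2r ?orbT.
Qed.

End Loops.

(* The environment of a loop body: [y.2] is the loop counter. *)
Definition ctx X (e : X -> data) (y : X * nat) := Node (e y.1) (Leaf (Posz y.2)).
Definition below X (P : X -> Prop) (m : X -> nat) (y : X * nat) := P y.1 /\ y.2 < m y.1.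

Lemma dsize_leaf_nat n : dsize (Leaf (Posz n)) <= n.+1.
Proof. by apply: dsize_leaf_le; rewrite /= ltn_expl. Qed.

Section Indexed.
Variables (X : Type) (P : X -> Prop) (e : X -> data) (m : X -> nat).

Lemma pt_idx (Q : X * nat -> Prop) : ptime Q (ctx e) (fun y => Leaf (Posz y.2)).
Proof. exact: pt_proj2. Qed.

Lemma pt_succ (Q : X * nat -> Prop) : ptime Q (ctx e) (fun y => Leaf (Posz y.2.+1)).
Proof.
apply: (pt_ext _ (pt_add (pt_idx Q) (pt_const Q (ctx e) (Leaf 1%R)))) => y _.
by rewrite addrC -intS.
Qed.

Lemma pt_lift (Q : X * nat -> Prop) f :
  (forall y, Q y -> P y.1) -> ptime P e f -> ptime Q (ctx e) (fun y => f y.1).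
Proof. move=> QP H; apply: (pt_trans (pt_proj1 Q (fun y => e y.1) _)).
exact: (pt_reindex (h := fst) QP H). Qed.

Lemma pt_below f : ptime P e f -> ptime (below P m) (ctx e) (fun y => f y.1).
Proof. by apply: pt_lift => y []. Qed.

Lemma pb_ctx : pbound P e m -> exists2 S, pbound P e S &
  forall x i, P x -> i <= m x -> dsize (ctx e (x, i)) <= S x.
Proof.
move=> Hm; exists (fun x => (dsize (e x) + (m x + 1)) + 1).
  by do !apply: pb_add => //; (exact: pb_size || exact: pb_const).
move=> x i Px lei; rewrite /ctx /= -/(dsize (Leaf (Posz i))) !addn1 ltnS leq_add2l.
exact: leq_trans (dsize_leaf_nat i) _.
Qed.

(** The counter stays below [m x], so a bound in terms of input and counter becomes one in terms of
    the input alone. *)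
Lemma pb_unif (f : X -> nat -> nat) : pbound P e m ->
  pbound (below P m) (ctx e) (fun y => f y.1 y.2) ->
  exists2 G, pbound P e G & forall x i, P x -> i < m x -> f x i <= G x.
Proof.
move=> /pb_ctx [S HS le_S] [c [k H]]; exists (fun x => c * S x ^ k).
  exact: pb_mul (pb_const _ _ c) (pb_exp _ HS).
move=> x i Px lti; apply: leq_trans (H (x, i) (conj Px lti)) _.
by rewrite leq_mul2l leq_wexp2r ?orbT // le_S // ltnW.
Qed.

(** The counter runs until [b] fails, so [m] need not be known beforehand. This yields the length of
    a list and, later, the least accepted scale. *)
Lemma pt_min (b : X * nat -> data) :
  (forall x i, P x -> i <= m x -> truth (b (x, i)) = (i < m x)) ->
  pbound P e m ->
  ptime (fun y => P y.1 /\ y.2 <= m y.1) (ctx e) b ->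
  ptime P e (fun x => Leaf (Posz (m x))).
Proof.
move=> Hb Hm pb; pose st x i := ctx e (x, i).
have stE : (fun y => st y.1 y.2) = ctx e by apply/funext; case.
have H0 : ptime P e (fun x => st x 0) := (pt_pair (pt_refl P e) (pt_const P e (Leaf 0))).
have e0 : pbound P (fun x => st x 0) (fun x => dsize (e x)).
  exact/ptime_pb/pt_proj1.
apply: pt_trans H0 _; suff : ptime P (fun x => st x 0) (fun x => st x (m x)).
  by move/pt_snd.
apply: (pt_while (b := b)) => //; rewrite ?stE //.
- apply: pt_pair; first exact: pt_proj1.
  exact: pt_succ.
- have [S HS le_S] := pb_ctx Hm.
  apply: (pb_le (g := fun y => S y.1)) => [[x i] [Px lei]|]; first exact: le_S.
  by apply: (pb_reindex (h := fst) _ (pb_trans e0 HS)) => y [].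
- exact: pb_trans e0 Hm.
Qed.

(** The state carries input, counter and accumulator. The guard is [i + 1 <= m] because the language
    compares only by [Le]. *)
Lemma pt_rec (g : X -> nat -> data) :
  ptime P e (fun x => Leaf (Posz (m x))) -> pbound P e m ->
  ptime P e (fun x => g x 0) ->
  ptime (below P m) (fun y => Node (ctx e y) (g y.1 y.2)) (fun y => g y.1 y.2.+1) ->
  pbound (fun y : X * nat => P y.1 /\ y.2 <= m y.1) (fun y => e y.1) (fun y => dsize (g y.1 y.2)) ->
  ptime P e (fun x => g x (m x)).
Proof.
move=> Hpm Hm g0 gS Hg; pose st x i := Node (ctx e (x, i)) (g x i).
have H0 : ptime P e (fun x => st x 0).
  exact: (pt_pair (pt_pair (pt_refl P e) (pt_const P e (Leaf 0))) g0).
have e0 : pbound P (fun x => st x 0) (fun x => dsize (e x)).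
  by apply/ptime_pb/pt_fst/pt_proj1.
apply: pt_trans H0 _; suff : ptime P (fun x => st x 0) (fun x => st x (m x)).
  by move/pt_snd.
have He Q : ptime Q (fun y => st y.1 y.2) (ctx e).
  by apply: (pt_ext _ (pt_proj1 _ _ _)) => -[].
apply: (pt_while (b := fun y => Leaf (Posz (Posz y.2 + 1 <= Posz (m y.1))%R))) => //.
- move=> x i Px _; rewrite /truth -[1%R]/(Posz 1) -PoszD addn1 lez_nat.
  by case: ltnP.
- apply: pt_trans (He _) _; apply: pt_le.
    exact: pt_add (pt_idx _) (pt_const _ _ (Leaf 1%R)).
  by apply: (pt_lift _ Hpm) => y [].
- apply: pt_pair; last exact: gS.
  apply: pt_trans (He _) _; apply: pt_pair; first exact: pt_proj1.
  exact: pt_succ.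
- have [S HS le_S] := pb_ctx Hm.
  apply: (pb_le (g := fun y => (S y.1 + dsize (g y.1 y.2)) + 1)) => [[x i] [Px lei]|].
    by rewrite addn1 ltnS leq_add2r le_S.
  apply: pb_add (pb_const _ _ 1); apply: pb_add.
    by apply: (pb_reindex (h := fst) _ (pb_trans e0 HS)) => y [].
  apply: pb_trans Hg.
  by apply: (pb_reindex (h := fst) _ e0) => y [].
- exact: pb_trans e0 Hm.
Qed.

(** Discharges the size hypothesis of [pt_rec]: additive growth by [G x] per round totals at most
    [m x * G x]. *)
Lemma pb_growth (g : X -> nat -> data) (G : X -> nat) :
  pbound P e m -> pbound P e (fun x => dsize (g x 0)) -> pbound P e G ->
  (forall x i, P x -> i < m x -> dsize (g x i.+1) <= dsize (g x i) + G x) ->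
  pbound (fun y : X * nat => P y.1 /\ y.2 <= m y.1) (fun y => e y.1)
    (fun y => dsize (g y.1 y.2)).
Proof.
move=> Hm H0 HG Hg.
apply: (pb_le (g := fun y => dsize (g y.1 0) + m y.1 * G y.1)); last first.
  by apply: (pb_reindex (h := fst) _ (pb_add H0 (pb_mul Hm HG))) => y [].
move=> [x i] [/= Px lei]; apply: (@leq_trans (dsize (g x 0) + i * G x)); last first.
  by rewrite leq_add2l leq_mul2r lei orbT.
elim: i lei => [|i IH] lti; first by rewrite addn0.
apply: leq_trans (Hg x i Px lti) _.
by rewrite mulSn addnCA addnC leq_add2l IH // ltnW.
Qed.

(** One product and one sum lengthen the accumulator by at most the sizes of the coefficients plus
    2, so the growth is additive. Sums, powers and mixed-radix numbers are all of this form. *)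
Lemma pt_affine (a b h : X -> nat -> int) :
  ptime P e (fun x => Leaf (Posz (m x))) -> pbound P e m ->
  ptime P e (fun x => Leaf (h x 0)) ->
  ptime (below P m) (ctx e) (fun y => Leaf (a y.1 y.2)) ->
  ptime (below P m) (ctx e) (fun y => Leaf (b y.1 y.2)) ->
  (forall x i, P x -> i < m x -> h x i.+1 = (a x i * h x i + b x i)%R) ->
  ptime P e (fun x => Leaf (h x (m x))).
Proof.
move=> Hpm Hm h0 Ha Hb hS.
apply: (pt_rec (g := fun x i => Leaf (h x i))) => //.
  have L f : ptime (below P m) (ctx e) f ->
      ptime (below P m) (fun y => Node (ctx e y) (Leaf (h y.1 y.2))) f.
    exact: pt_ctx1.
  apply: (pt_ext _ (pt_add (pt_mul (L _ Ha) (pt_proj2 _ _ _)) (L _ Hb))) => -[x i] [/= Px lti].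
  by rewrite hS.
have [A HA le_A] := pb_unif (f := fun x i => dsize (Leaf (a x i))) Hm (ptime_pb Ha).
have [B HB le_B] := pb_unif (f := fun x i => dsize (Leaf (b x i))) Hm (ptime_pb Hb).
apply: (pb_growth (g := fun x i => Leaf (h x i)) (G := fun x => (A x + B x) + 2)) => //.
  exact: ptime_pb.
  by apply: pb_add (pb_const _ _ 2); exact: pb_add.
move=> x i Px lti; rewrite hS //.
have hD := dsize_leafD (a x i * h x i)%R (b x i).
have hM := dsize_leafM (a x i) (h x i).
have hA : dsize (Leaf (a x i)) <= A x := le_A x i Px lti.
have hB : dsize (Leaf (b x i)) <= B x := le_B x i Px lti.
move: hD hM hA hB; move: (dsize (Leaf (_ + _)%R)) (dsize (Leaf (_ * _)%R)).
move: (dsize (Leaf (a x i))) (dsize (Leaf (b x i))) (dsize (Leaf (h x i))).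
lia.
Qed.

Lemma pt_sum (b : X -> nat -> int) :
  ptime P e (fun x => Leaf (Posz (m x))) -> pbound P e m ->
  ptime (below P m) (ctx e) (fun y => Leaf (b y.1 y.2)) ->
  ptime P e (fun x => Leaf (\sum_(i < m x) b x i)%R).
Proof.
move=> Hpm Hm Hb.
apply: (pt_affine (a := fun _ _ => 1%R) (b := b)
  (h := fun x k => \sum_(i < k) b x i)%R) => //.
- by apply: (pt_ext _ (pt_const _ _ (Leaf 0))) => x _; rewrite big_ord0.
- exact: pt_const.
- by move=> x i _ _; rewrite big_ord_recr /= mul1r addrC.
Qed.

Lemma pt_exp (a : X -> int) :
  ptime P e (fun x => Leaf (Posz (m x))) -> pbound P e m ->
  ptime P e (fun x => Leaf (a x)) ->
  ptime P e (fun x => Leaf (a x ^+ m x)%R).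
Proof.
move=> Hpm Hm Ha.
apply: (pt_affine (a := fun x _ => a x) (b := fun _ _ => 0%R)
  (h := fun x k => a x ^+ k)%R) => //.
- exact: (pt_const P e (Leaf 1%R)).
- exact: pt_below Ha.
- exact: pt_const.
- by move=> x i _ _; rewrite exprS addr0.
Qed.

Lemma pt_mkseq (f : X -> nat -> data) :
  ptime P e (fun x => Leaf (Posz (m x))) -> pbound P e m ->
  ptime (below P m) (ctx e) (fun y => f y.1 y.2) ->
  ptime P e (fun x => enc_seq (mkseq (f x) (m x))).
Proof.
move=> Hpm Hm Hf.
(* Entries are put in front, so the list is built from its end: after [k] rounds it holds the last
   [k] entries. *)
apply: (pt_ext (f := fun x => enc_seq [seq f x i | i <- iota (m x - m x) (m x)])) => [x _|].
  by rewrite subnn.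
apply: (pt_rec (g := fun x k => enc_seq [seq f x i | i <- iota (m x - k) k])) => //.
- exact: pt_const.
- apply: (pt_ext (f := fun y => Node (f y.1 (m y.1 - y.2.+1))
      (enc_seq [seq f y.1 i | i <- iota (m y.1 - y.2) y.2]))) => [[x i] [/= Px lti]|].
    by rewrite subnSK.
  apply: pt_pair (pt_proj2 _ _ _); apply: pt_ctx1.
  have /(pt_reindex (Q := below P m)) := Hf.
  move/(_ (fun y => (y.1, m y.1 - y.2.+1))) => H.
  apply: pt_trans (H _) => [|[x i] [/= Px lti]]; last by split=> //=; lia.
  apply: pt_pair; first exact: pt_proj1.
  apply: (pt_ext _ (pt_sub (pt_sub (pt_below Hpm) (pt_idx _)) (pt_const _ _ (Leaf 1%R)))).
  by move=> [x i] [/= Px lti]; congr Leaf; lia.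
- have [A HA le_A] := pb_unif (f := fun x i => dsize (f x i)) Hm (ptime_pb Hf).
  apply: (pb_growth (g := fun x k => enc_seq [seq f x i | i <- iota (m x - k) k])
    (G := fun x => A x + 1)) => //; first exact: pb_const.
    exact: pb_add HA (pb_const _ _ 1).
  move=> x i Px lti; rewrite subnS -(prednK (n := m x - i)) ?subn_gt0 //=.
  have hA : dsize (f x (m x - i).-1) <= A x by apply: le_A => //; lia.
by rewrite addnC -addnS leq_add2l addn1 ltnS.
Qed.

End Indexed.

(** * Access to encoded lists *)

Lemma size_le_dsize (s : seq data) : size s <= dsize (enc_seq s).
Proof.
by elim: s => //= d s IH; rewrite ltnS; apply: leq_trans IH (leq_addl _ _).
Qed.

Lemma dsize_drop (s : seq data) k : dsize (enc_seq (drop k s)) <= dsize (enc_seq s).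
Proof.
elim: s k => // d s IH [|k] //; rewrite drop_cons.
by apply: leq_trans (IH k) _; rewrite /= leqW // leq_addl.
Qed.

Section Sequences.
Variables (X : Type) (P : X -> Prop) (e : X -> data) (s : X -> seq data).
Hypothesis es : ptime P e (fun x => enc_seq (s x)).

Lemma pb_length : pbound P e (fun x => size (s x)).
Proof. by apply: pb_le (ptime_pb es) => x _; exact: size_le_dsize. Qed.

Lemma pt_drop (i : X -> nat) : (forall x, P x -> i x <= size (s x)) ->
  ptime P e (fun x => Leaf (Posz (i x))) -> ptime P e (fun x => enc_seq (drop (i x) (s x))).
Proof.
move=> le_i Hi; have Hb : pbound P e i by apply: pb_le pb_length.
apply: (pt_rec (g := fun x k => enc_seq (drop k (s x)))) => //.
- by apply: pt_ext es => x _; rewrite drop0.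
- apply: pt_trans (pt_proj2 _ _ _) _.
  apply: (pt_prim (o := Snd)).
    move=> [x k] [/= Px ltk]; rewrite (drop_nth (Leaf 0)) //.
    exact: leq_trans ltk (le_i x Px).
  apply: pb_le (pb_size _ _) => -[x k] _ /=.
  by rewrite -addn1 addnC -drop_drop dsize_drop.
- apply: (pb_le (g := fun y => dsize (enc_seq (s y.1)))) => [y _|]; first exact: dsize_drop.
  by apply: (pb_reindex (h := fst) _ (ptime_pb es)) => y [].
Qed.

Lemma pt_nth (i : X -> nat) : (forall x, P x -> i x < size (s x)) ->
  ptime P e (fun x => Leaf (Posz (i x))) -> ptime P e (fun x => nth (Leaf 0) (s x) (i x)).
Proof.
move=> lt_i Hi; apply: (@pt_fst _ _ _ _ (fun x => enc_seq (drop (i x).+1 (s x)))).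
apply: (pt_ext _ (pt_drop (fun x Px => ltnW (lt_i x Px)) Hi)) => x Px.
by rewrite (drop_nth (Leaf 0)) ?lt_i.
Qed.

End Sequences.

(** The empty list is encoded by [Leaf 0], which counts as false, while a [Node] counts as true; so
    the remaining tail itself is the loop guard. *)
Lemma pt_size X (P : X -> Prop) e s :
  ptime P e (fun x => enc_seq (s x)) -> ptime P e (fun x => Leaf (Posz (size (s x)))).
Proof.
move=> es; apply: (pt_min (b := fun y => enc_seq (drop y.2 (s y.1)))).
- by move=> x i Px _ /=; rewrite -subn_gt0 -size_drop; case: (drop i (s x)).
- exact: pb_length es.
- apply: (pt_drop (s := fun y => s y.1)) (pt_idx _ _) => [|y []//].
  by apply: pt_lift es => y [].
Qed.

(** * Packing the linear forms *)

Local Open Scope ring_scope.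

(** Horner scheme, shaped as the recurrence of [pt_affine]. *)
Fixpoint affine (a b : nat -> int) (h0 : int) (m : nat) : int :=
  if m is m'.+1 then a m' * affine a b h0 m' + b m' else h0.

Definition sign (z : int) := z \in [:: -1; 0; 1].

Lemma norm_sign z : sign z -> `|z| <= 1.
Proof. by rewrite /sign !inE => /or3P[] /eqP->. Qed.

(** Parity: if the lowest digit is nonzero the sum is odd; otherwise a factor 2 splits off and
    induction applies. *)
Lemma binary_neq0 (z : nat -> int) (L : nat) :
  (forall l, (l < L)%N -> sign (z l)) -> (exists2 l, (l < L)%N & z l != 0) ->
  \sum_(l < L) 2 ^+ l * z l != 0.
Proof.
elim: L z => [|L IH] z Hz [l lt_l nz]; first by [].
rewrite big_ord_recl /= expr0 mul1r.
under eq_bigr => i _ do rewrite /bump add1n exprS -mulrA.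
rewrite -mulr_sumr; set S := \sum_(i < L) _.
have := Hz 0%N isT; rewrite /sign !inE => /or3P[] /eqP z0; rewrite z0; try lia.
rewrite add0r mulf_neq0 //; apply: (IH (fun l => z l.+1)) => [k ltk|]; first exact: Hz.
by case: l lt_l nz => [|l] lt_l nz; [rewrite z0 in nz | exists l].
Qed.

Section Packing.
Variables (T : nat -> int) (B : nat -> nat -> int) (N : nat).

(* Mixed-radix numbers in Horner form, the most significant digit being [B 0 k]. *)
Definition packed k m := affine (fun i => T i + 1) (fun i => B i k) 0 m.
Definition modulus m := affine (fun i => T i + 1) (fun=> 0) 1 m.

Lemma packedS k i : packed k i.+1 = (T i + 1) * packed k i + B i k.
Proof. by []. Qed.

Lemma modulusS i : modulus i.+1 = (T i + 1) * modulus i.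
Proof. by rewrite /modulus /= addr0. Qed.

Variable m : nat.
Hypothesis B_ge0 : forall i k, (i < m)%N -> (k < N)%N -> 0 <= B i k.
Hypothesis sum_B : forall i, (i < m)%N -> \sum_(k < N) B i k <= T i.

Lemma T_ge0 i : (i < m)%N -> 0 <= T i.
Proof. by move=> lti; apply: le_trans (sum_B lti); apply: sumr_ge0 => k _; exact: B_ge0. Qed.

Lemma packed_ge0 k i : (k < N)%N -> (i <= m)%N -> 0 <= packed k i.
Proof.
move=> ltk; elim: i => [|i IH] // lti.
by rewrite packedS addr_ge0 ?B_ge0 // mulr_ge0 ?IH 1?ltnW // addr_ge0 ?T_ge0.
Qed.

(** Analogue of 99...9 being one less than a power of ten: [(T + 1) (M - 1) + T = (T + 1) M - 1]. It
    bounds the total over all items, and so each packed number as well. *)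
Lemma sum_packed i : (i <= m)%N -> \sum_(k < N) packed k i <= modulus i - 1.
Proof.
elim: i => [|i IH] lti; first by rewrite big1.
under eq_bigr => k _ do rewrite packedS.
rewrite big_split -mulr_sumr modulusS.
apply: le_trans (lerD (ler_wpM2l _ (IH (ltnW lti))) (sum_B lti)) _.
  by rewrite addr_ge0 ?T_ge0.
by rewrite le_eqVlt; apply/orP; left; apply/eqP; ring.
Qed.

Lemma modulus_gt0 i : (i <= m)%N -> 0 < modulus i.
Proof.
move=> lei; have := sum_packed lei; rewrite -subr_ge0.
have : 0 <= \sum_(k < N) packed k i by apply: sumr_ge0 => k _; exact: packed_ge0.
lia.
Qed.

Lemma packed_lt k i : (k < N)%N -> (i <= m)%N -> packed k i < modulus i.
Proof.
move=> ltk lei; have := sum_packed lei; rewrite (bigD1 (Ordinal ltk)) //=.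
have : 0 <= \sum_(j < N | j != Ordinal ltk) packed j i.
  by apply: sumr_ge0 => j _; exact: packed_ge0.
lra.
Qed.

(** Digits are removed from the least significant end. The sum has the form [(T + 1) S + v], where
    [|v| <= T] since the nonnegative digits of a row total at most [T]; if it vanishes, then [S = 0]
    and [v = 0]. *)
Lemma unpack (z : nat -> int) : (forall k, (k < N)%N -> sign (z k)) ->
  \sum_(k < N) z k * packed k m = 0 ->
  forall i, (i < m)%N -> \sum_(k < N) z k * B i k = 0.
Proof.
move=> Hz; suff L i : (i <= m)%N -> \sum_(k < N) z k * packed k i = 0 ->
    forall j, (j < i)%N -> \sum_(k < N) z k * B j k = 0 by exact: L.
elim: i => // i IH lti.
under eq_bigr => k _ do rewrite packedS mulrDr mulrCA.
rewrite big_split -mulr_sumr => E.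
have le_v : `|\sum_(k < N) z k * B i k| <= T i.
  apply: le_trans (ler_norm_sum _ _ _) (le_trans _ (sum_B lti)).
  apply: ler_sum => k _; rewrite normrM (ger0_norm (B_ge0 _ _)) //.
  by rewrite -[leRHS]mul1r ler_wpM2r ?B_ge0 ?norm_sign ?Hz.
have [S0 v0] : \sum_(k < N) z k * packed k i = 0 /\ \sum_(k < N) z k * B i k = 0.
  have := T_ge0 lti; set S := \sum_(k < N) z k * packed k i in E *.
  move: E le_v; rewrite /=; set v := \sum_(k < N) _ * B i k; move: (T i) => t E le_v t0.
  have S0 : S = 0 by move: S v E le_v => S v; nia.
  by split=> //; move: E; rewrite S0 mulr0 add0r.
by move=> j; rewrite ltnS leq_eqVlt => /predU1P[->//|]; exact: (IH (ltnW lti) S0 j).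
Qed.

End Packing.

(** * The rounded and packed instance at a given scale *)

Lemma sum_divn_modn (V : nmodType) (F : nat -> nat -> V) p q : (0 < q)%N ->
  \sum_(k < p * q) F (k %/ q)%N (k %% q)%N = \sum_(j < p) \sum_(l < q) F j l.
Proof.
move=> q0; elim: p => [|p IH]; first by rewrite !big_ord0.
rewrite mulSnr big_split_ord big_ord_recr /= IH; congr (_ + _).
by apply: eq_bigr => l _; rewrite divnMDl // modnMDl divn_small // modn_small // addn0.
Qed.

Lemma divz_floor (u v : int) : 0 <= u -> 0 < v ->
  0 <= (u %/ v)%Z /\ 0 <= (u%:~R / v%:~R - (u %/ v)%Z%:~R : rat) < 1.
Proof.
move=> u0 v0; split; first by rewrite divz_ge0.
have E := divz_eq u v; have r0 := modz_ge0 u (lt0r_neq0 v0); have r1 := ltz_pmod u v0.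
have v0' : (0 : rat) < v%:~R by rewrite ltr0z.
have -> : u%:~R / v%:~R - (u %/ v)%Z%:~R = (u %% v)%Z%:~R / v%:~R :> rat.
  by rewrite {1}E intrD intrM; field; rewrite lt0r_neq0.
by rewrite divr_ge0 ?ler0z //= ?ltW // ltr_pdivrMr // mul1r ltr_int.
Qed.

Lemma sum_pow2 (L : nat) : \sum_(l < L) 2 ^+ l = 2 ^+ L - 1 :> rat.
Proof. by elim: L => [|L IH]; rewrite ?big_ord0 ?subrr // big_ord_recr /= IH exprS; ring. Qed.

(** Besides giving [4 n^2] items, this leaves enough room: [lam i <= 2^n] and [s <= 2 n + 2] imply
    [lam i * 2^s <= 2 * 2^(4 n)]. *)
Definition nbits (n : nat) := (4 * n)%N.
Definition nitems (n : nat) := (n * nbits n)%N.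

Lemma bit_index_lt n j l : (j < n)%N -> (l < nbits n)%N -> (j * nbits n + l < nitems n)%N.
Proof.
move=> ltj ltl; apply: (@leq_trans (j.+1 * nbits n)%N); first by rewrite mulSnr ltn_add2l.
by rewrite /nitems leq_mul2r ltj orbT.
Qed.

Section Reduction.
Variables (n : nat) (A : nat -> nat -> rat) (lam : nat -> rat) (s : nat).

(** Here and in [row_coef], numerators and denominators are multiplied out, so that the floor is a
    single integer division available in the language. *)
Definition row_bound (i : nat) : int :=
  ((2 ^+ nbits n * denq (lam i)) %/ (numq (lam i) * 2 ^+ s))%Z.

Definition row_coef (i k : nat) : int :=
  let a := A i (k %/ nbits n)%N in
  ((2 ^+ (k %% nbits n) * (numq a * denq (lam i)))
     %/ (denq a * (numq (lam i) * (Posz n * 2 ^+ s))))%Z.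

Definition item_weight (k : nat) : int := packed row_bound row_coef k n.
Definition total_modulus : int := modulus row_bound n.
(* The numerator [W_k F + 1] is coprime to [D F], where [F] is the slack, because
  [D] divides [F]; so the fraction fed to the oracle is in lowest terms and no
  gcd has to be computed.  The perturbation is harmless as [F >= 8 N]. *)
Definition slack : int := total_modulus * Posz (8 * nitems n).
Definition item_num (k : nat) : int := item_weight k * slack + 1.
Definition item_den : int := total_modulus * slack.
Definition item (k : nat) : rat := (item_num k)%:~R / item_den%:~R.

Definition decode (z : nat -> int) (j : nat) : int :=
  \sum_(l < nbits n) 2 ^+ l * z (j * nbits n + l)%N.

Hypothesis n_gt0 : (0 < n)%N.
Hypothesis A01 : forall i j, (i < n)%N -> (j < n)%N -> 0 <= A i j <= 1.
Hypothesis lam_gt0 : forall i, (i < n)%N -> 0 < lam i.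

Let nbits_gt0 : (0 < nbits n)%N. Proof. by rewrite muln_gt0. Qed.
Let nitems_gt0 : (0 < nitems n)%N. Proof. by rewrite !muln_gt0 n_gt0. Qed.

Let mu i : rat := lam i * (n%:R * 2 ^+ s).

Lemma mu_gt0 i : (i < n)%N -> 0 < mu i.
Proof. by move=> lti; rewrite !mulr_gt0 ?lam_gt0 ?ltr0n ?exprn_gt0. Qed.

Lemma row_bound_floor i : (i < n)%N ->
  0 <= 2 ^+ nbits n / (lam i * 2 ^+ s) - (row_bound i)%:~R < 1.
Proof.
move=> lti; have l0 : 0 < numq (lam i) by rewrite numq_gt0 lam_gt0.
have l0' : (numq (lam i))%:~R != 0 :> rat by rewrite intr_eq0 lt0r_neq0.
have d0' : (denq (lam i))%:~R != 0 :> rat by rewrite intr_eq0 denq_neq0.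
have u0 : 0 <= 2 ^+ nbits n * denq (lam i) by rewrite mulr_ge0 ?exprn_ge0.
have v0 : 0 < numq (lam i) * 2 ^+ s by rewrite mulr_gt0 ?exprn_gt0.
have E : (2 ^+ nbits n * denq (lam i))%:~R / (numq (lam i) * 2 ^+ s)%:~R
    = 2 ^+ nbits n / (lam i * 2 ^+ s) :> rat.
  have p0 : 2 ^+ s != 0 :> rat by rewrite expf_neq0.
  rewrite !intrM !rmorphXn -[in RHS](divq_num_den (lam i)) [intr]lock /= -lock.
  move: (2 ^+ s) p0 (2 ^+ nbits n) (numq _)%:~R (denq _)%:~R l0' d0' => p p0 q x y x0 y0.
  by field; rewrite y0 p0 x0.
by have [_] := divz_floor u0 v0; rewrite E.
Qed.

Lemma row_coef_floor i k : (i < n)%N -> (k < nitems n)%N ->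
  0 <= row_coef i k /\
  0 <= 2 ^+ (k %% nbits n) * A i (k %/ nbits n)%N / mu i - (row_coef i k)%:~R < 1.
Proof.
move=> lti ltk; have l0 : 0 < numq (lam i) by rewrite numq_gt0 lam_gt0.
have l0' : (numq (lam i))%:~R != 0 :> rat by rewrite intr_eq0 lt0r_neq0.
have d0' : (denq (lam i))%:~R != 0 :> rat by rewrite intr_eq0 denq_neq0.
rewrite /row_coef; set a := A i _.
have a0 : 0 <= numq a.
  have ltj : (k %/ nbits n < n)%N by rewrite ltn_divLR.
  by rewrite numq_ge0; case/andP: (A01 lti ltj).
have da0' : (denq a)%:~R != 0 :> rat by rewrite intr_eq0 denq_neq0.
have u0 : 0 <= 2 ^+ (k %% nbits n) * (numq a * denq (lam i)).
  by rewrite mulr_ge0 ?exprn_ge0 // mulr_ge0.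
have v0 : 0 < denq a * (numq (lam i) * (Posz n * 2 ^+ s)).
  by rewrite mulr_gt0 // mulr_gt0 // mulr_gt0 ?exprn_gt0.
have E : (2 ^+ (k %% nbits n) * (numq a * denq (lam i)))%:~R /
    (denq a * (numq (lam i) * (Posz n * 2 ^+ s)))%:~R
    = 2 ^+ (k %% nbits n) * a / mu i :> rat.
  have p0 : 2 ^+ s != 0 :> rat by rewrite expf_neq0.
  have n0 : n%:R != 0 :> rat by rewrite pnatr_eq0 -lt0n.
  rewrite /mu -[in RHS](divq_num_den (lam i)) -[in RHS](divq_num_den a).
  rewrite !intrM !rmorphXn -pmulrn [intr]lock /= -lock.
  move: (2 ^+ s) p0 (2 ^+ (k %% _)) (numq _)%:~R (denq _)%:~R l0' d0' => p p0 q x y x0 y0.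
  move: (numq a)%:~R (denq a)%:~R da0' n%:R n0 => u v v0' w w0.
  by field; rewrite y0 p0 w0 x0.
by have [] := divz_floor u0 v0; rewrite E.
Qed.

Lemma row_coef_ge0 i k : (i < n)%N -> (k < nitems n)%N -> 0 <= row_coef i k.
Proof. by move=> lti /(row_coef_floor lti)[]. Qed.

(** With entries at most 1 the unrounded sum is at most [n (2^(4 n) - 1) / mu i]. The factor [n] in
    [mu] cancels the number of columns, leaving a value below [row_bound i + 1]; integrality
    finishes. *)
Lemma sum_row_coef i : (i < n)%N -> \sum_(k < nitems n) row_coef i k <= row_bound i.
Proof.
move=> lti; rewrite -ltzD1 -(ltr_int rat) rmorph_sum intrD /=.
have /andP[_ ltT] := row_bound_floor lti; have mi := mu_gt0 lti.
apply: (@le_lt_trans _ _ (2 ^+ nbits n / (lam i * 2 ^+ s))); last by lra.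
apply: (@le_trans _ _ (\sum_(k < nitems n) 2 ^+ (k %% nbits n) / mu i)).
  apply: ler_sum => k _; have [_ /andP[le_c _]] := row_coef_floor lti (ltn_ord k).
  have ltk : (k %/ nbits n < n)%N by rewrite ltn_divLR.
  have /andP[_ le1] := A01 lti ltk.
  move: le_c; rewrite subr_ge0 => /le_trans; apply.
  apply: ler_wpM2r; first by rewrite invr_ge0 ltW.
  by rewrite -[leRHS]mulr1 ler_wpM2l ?exprn_ge0.
rewrite /nitems (sum_divn_modn (fun _ l => 2 ^+ l / mu i)) //.
rewrite sumr_const card_ord -mulr_suml sum_pow2 -[_ *+ n]mulr_natr.
have n0 : n%:R != 0 :> rat by rewrite pnatr_eq0 -lt0n.
have -> : (2 ^+ nbits n - 1) / mu i * n%:R = (2 ^+ nbits n - 1) / (lam i * 2 ^+ s).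
  by rewrite /mu; field; rewrite expf_neq0 // n0 lt0r_neq0 ?lam_gt0.
apply: ler_wpM2r; last by rewrite gerBl.
by rewrite invr_ge0 mulr_ge0 ?exprn_ge0 // ltW ?lam_gt0.
Qed.

(** The integer parts cancel by hypothesis, so the form equals [mu i] times a signed sum of
    [nitems n] fractional parts, each in [[0, 1)]. *)
Lemma decode_error (z : nat -> int) i :
  (forall k, (k < nitems n)%N -> sign (z k)) -> (i < n)%N ->
  \sum_(k < nitems n) z k * row_coef i k = 0 ->
  `|\sum_(j < n) (decode z j)%:~R * A i j| <= mu i * (nitems n)%:R.
Proof.
move=> Hz lti E; have mi := mu_gt0 lti.
have -> : \sum_(j < n) (decode z j)%:~R * A i j =
    mu i * \sum_(k < nitems n) (z k)%:~R * (2 ^+ (k %% nbits n) * A i (k %/ nbits n)%N / mu i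
       - (row_coef i k)%:~R).
  under [in RHS]eq_bigr => k _ do rewrite mulrBr -intrM.
  rewrite sumrB -rmorph_sum E subr0 mulr_sumr.
  transitivity (\sum_(j < n) \sum_(l < nbits n) (2 ^+ l * z (j * nbits n + l)%N)%:~R * A i j).
    by apply: eq_bigr => j _; rewrite /decode rmorph_sum mulr_suml.
  rewrite -(sum_divn_modn (fun j l => (2 ^+ l * z (j * nbits n + l)%N)%:~R * A i j)) //.
  apply: eq_bigr => k _; rewrite -divn_eq intrM rmorphXn /=; field.
  by rewrite lt0r_neq0.
rewrite normrM (gtr0_norm mi); apply: ler_wpM2l; first exact: ltW.
apply: le_trans (ler_norm_sum _ _ _) _.
have -> : (nitems n)%:R = \sum_(k < nitems n) 1 :> rat by rewrite sumr_const card_ord.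
apply: ler_sum => k _; have [_ /andP[ge0 lt1]] := row_coef_floor lti (ltn_ord k).
rewrite normrM (ger0_norm ge0) -[leRHS]mul1r; apply: ler_pM (ltW lt1) => //.
by rewrite -intr_norm (ler_int _ _ 1) norm_sign ?Hz.
Qed.

Lemma total_modulus_gt0 : 0 < total_modulus.
Proof. exact: modulus_gt0 row_coef_ge0 sum_row_coef _ (leqnn n). Qed.

Lemma slack_gt0 : 0 < slack.
Proof. by rewrite mulr_gt0 ?total_modulus_gt0 // ltz_nat muln_gt0. Qed.

Lemma item_den_gt0 : 0 < item_den.
Proof. by rewrite mulr_gt0 ?total_modulus_gt0 ?slack_gt0. Qed.

Lemma item_coprime k : coprime `|item_num k| `|item_den|.
Proof.
rewrite -coprimezE /item_den coprimezMr.
have cs : coprimez (item_num k) slack.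
  by rewrite /item_num coprimez_sym /coprimez gcdzMDl gcdz1.
rewrite cs andbT; move: cs; rewrite {1}/slack coprimezMr; by case/andP.
Qed.

Lemma numq_item k : numq (item k) = item_num k.
Proof. by rewrite coprimeq_num ?item_coprime // gtr0_sg ?item_den_gt0 ?mul1r. Qed.

Lemma denq_item k : denq (item k) = item_den.
Proof.
rewrite coprimeq_den ?item_coprime // gt_eqF ?item_den_gt0 // gtr0_norm //.
exact: item_den_gt0.
Qed.

Lemma item_weight_bounds k : (k < nitems n)%N -> 0 <= item_weight k < total_modulus.
Proof.
move=> ltk; apply/andP; split.
- exact: packed_ge0 row_coef_ge0 sum_row_coef _ _ ltk (leqnn n).
- exact: packed_lt row_coef_ge0 sum_row_coef _ _ ltk (leqnn n).
Qed.

Lemma item_01 k : (k < nitems n)%N -> 0 <= item k <= 1.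
Proof.
move=> ltk; have /andP[w0 w1] := item_weight_bounds ltk.
have D0 := item_den_gt0; have S0 := slack_gt0.
have num0 : 0 <= item_num k by apply: addr_ge0 => //; apply: mulr_ge0 => //; exact: ltW.
rewrite divr_ge0 ?ler0z ?(ltW D0) //= ler_pdivrMr ?ltr0z // mul1r ler_int.
(* From [W <= D - 1] and [F >= 1] follows [W F + 1 <= D F]. *)
by rewrite /item_num /item_den; nia.
Qed.

(** The scaled value is [S + Z / F], where [S] is a nonzero integer, [|Z| <= N] and [F = 8 N D]. The
    perturbation is at most 1/8, which leaves at least 7/8. *)
Lemma rejected (z : nat -> int) :
  (forall k, (k < nitems n)%N -> sign (z k)) ->
  \sum_(k < nitems n) z k * item_weight k != 0 ->
  3 / 4 < total_modulus%:~R * `|\sum_(k < nitems n) (z k)%:~R * item k|.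
Proof.
move=> Hz; set S := \sum_(k < nitems n) _ => S0.
have D0 : 0 < total_modulus%:~R :> rat by rewrite ltr0z total_modulus_gt0.
have F0 : 0 < slack%:~R :> rat by rewrite ltr0z slack_gt0.
pose Z := \sum_(k < nitems n) z k.
have -> : \sum_(k < nitems n) (z k)%:~R * item k =
    (S%:~R + Z%:~R / slack%:~R) / total_modulus%:~R.
  rewrite /S /Z !rmorph_sum mulr_suml -big_split mulr_suml /=.
  apply: eq_bigr => k _; rewrite /item /item_num /item_den.
  move: slack total_modulus F0 D0 => f d f0 d0; rewrite !(intrM, intrD).
  by field; rewrite !lt0r_neq0.
rewrite normrM normfV (gtr0_norm D0) [X in _ < X]mulrC divfK ?lt0r_neq0 //.
have leZ : `|Z%:~R / slack%:~R| <= 1 / 8 :> rat.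
  rewrite normrM normfV (gtr0_norm F0) ler_pdivrMr // /slack.
  have D1 : 1 <= total_modulus%:~R :> rat by rewrite ler1z -gtz0_ge1 total_modulus_gt0.
  apply: (@le_trans _ _ (nitems n)%:R).
    rewrite -intr_norm [leRHS]pmulrn ler_int.
    apply: le_trans (ler_norm_sum _ _ _) _.
    apply: (@le_trans _ _ (\sum_(k < nitems n) 1)).
      by apply: ler_sum => k _; rewrite norm_sign ?Hz.
    by rewrite sumr_const card_ord -natz.
  rewrite intrM -pmulrn (natrM _ 8 (nitems n)).
  have N0 : 0 <= (nitems n)%:R :> rat by rewrite ler0n.
  move: D1 N0; move: (total_modulus%:~R) ((nitems n)%:R) => d N1 d1 N0.
  have := mulr_ge0 N0 (etrans (subr_ge0 _ _) d1); rewrite mulrBr mulr1; lra.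
have leS : 1 <= `|S%:~R| :> rat by rewrite -intr_norm ler1z -gtz0_ge1 normr_gt0.
have := lerB_normD S%:~R (Z%:~R / slack%:~R : rat); lra.
Qed.

(** Write [q] for [2^(4 n) / (lam i * 2^s)]. The first hypothesis says [q >= 1/2], so each base is
    at most [q + 1 <= 3 q]; in the product over [i] the radii are absorbed by the second
    hypothesis. *)
Lemma total_modulus_le :
  (forall i, (i < n)%N -> lam i * 2 ^+ s <= 2 * 2 ^+ nbits n) ->
  1 <= \prod_(i < n) lam i ->
  total_modulus%:~R * (2 ^+ s) ^+ n <= 3 ^+ n * 2 ^+ nitems n :> rat.
Proof.
move=> Hl Hp; pose r i : rat := 3 * 2 ^+ nbits n / (lam i * 2 ^+ s).
have r0 i : (i < n)%N -> 0 <= r i.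
  by move=> lti; rewrite divr_ge0 ?mulr_ge0 ?exprn_ge0 // ltW ?lam_gt0.
have L m : (m <= n)%N -> (modulus row_bound m)%:~R <= \prod_(i < m) r i.
  elim: m => [|m IH] lem; first by rewrite big_ord0.
  have d0 : 0 <= (modulus row_bound m)%:~R :> rat.
    by rewrite ler0z ltW //; exact: modulus_gt0 row_coef_ge0 sum_row_coef _ (ltnW lem).
  have T0 : 0 <= row_bound m by apply: le_trans (sum_row_coef lem); apply: sumr_ge0 => k _;
    exact: row_coef_ge0.
  rewrite big_ord_recr /= modulusS intrM mulrC.
  apply: ler_pM => //; [by rewrite ler0z addr_ge0 | exact/IH/ltnW |].
  have /andP[le_T _] := row_bound_floor lem.
  have p0 : 0 < lam m * 2 ^+ s by rewrite mulr_gt0 ?lam_gt0 ?exprn_gt0.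
  have : 1 <= 2 * (2 ^+ nbits n / (lam m * 2 ^+ s)).
    by rewrite mulrA ler_pdivlMr // mul1r Hl.
  rewrite /r intrD -mulrA; lra.
have E : (\prod_(i < n) r i) * (\prod_(i < n) lam i) * (2 ^+ s) ^+ n = 3 ^+ n * 2 ^+ nitems n.
  rewrite -big_split /= -[X in _ ^+ X](card_ord n) -prodr_const -big_split /=.
  rewrite (eq_bigr (fun=> 3 * 2 ^+ nbits n)).
    by rewrite prodr_const card_ord exprMn -exprM mulnC.
  move=> i _; rewrite /r; field.
  by rewrite expf_neq0 // lt0r_neq0 ?lam_gt0.
rewrite -E ler_wpM2r ?exprn_ge0 //.
apply: le_trans (L n (leqnn n)) _; rewrite -[leLHS]mulr1 ler_wpM2l //.
by apply: prodr_ge0 => i _; apply: r0.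
Qed.

Lemma decode_neq0 (z : nat -> int) :
  (forall k, (k < nitems n)%N -> sign (z k)) ->
  (exists2 k, (k < nitems n)%N & z k != 0) ->
  exists2 j, (j < n)%N & decode z j != 0.
Proof.
move=> Hz [k ltk zk]; exists (k %/ nbits n)%N; first by rewrite ltn_divLR.
have ltj : (k %/ nbits n < n)%N by rewrite ltn_divLR.
apply: (binary_neq0 (z := fun l => z (k %/ nbits n * nbits n + l)%N)).
- by move=> l ltl; apply/Hz/bit_index_lt.
- by exists (k %% nbits n)%N; rewrite ?ltn_pmod // -divn_eq.
Qed.

End Reduction.

Local Close Scope ring_scope.

(** * The algorithm *)

Lemma map_enum_mkseq T n (F : 'I_n -> T) (f : nat -> T) :
  (forall j, F j = f j) -> [seq F j | j <- enum 'I_n] = mkseq f n.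
Proof. by move=> E; rewrite /mkseq -val_enum_ord -map_comp; exact: eq_map. Qed.

(** Plain functions avoid types depending on the dimension. The encodings read only indices below
    [n], so the default never shows. *)
Definition of_ord T (d : T) n (f : 'I_n -> T) (k : nat) : T :=
  if insub k is Some j then f j else d.

Lemma of_ordE T (d : T) n (f : 'I_n -> T) (j : 'I_n) : of_ord d f j = f j.
Proof. by rewrite /of_ord valK. Qed.

Definition enc_rats n (a : nat -> rat) := enc_seq (mkseq (fun k => enc_rat (a k)) n).
Definition enc_ints n (z : nat -> int) := enc_seq (mkseq (fun k => Leaf (z k)) n).
Definition enc_mx n (A : nat -> nat -> rat) := enc_seq (mkseq (fun i => enc_rats n (A i)) n).

Definition balances (R : realType) (delta : nat -> R) n (a : nat -> rat) (z : nat -> int) :=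
  [/\ forall k, k < n -> sign (z k),
      exists2 k, k < n & (z k != 0)%R
    & (`|ratr (\sum_(k < n) (z k)%:~R * a k)| <= delta n)%R].

Definition unit_weights (y : nat * (nat -> rat)) :=
  0 < y.1 /\ forall k, k < y.1 -> (0 <= y.2 k <= 1)%R.

(** Choice fixes one answer per instance, so that the answer is a function of the input and can
    serve as an encoding in [ptime]. The program itself is unchanged. *)
Lemma oracle_function (R : realType) (delta : nat -> R) :
  number_balancing_approximation delta ->
  exists Z : nat * (nat -> rat) -> nat -> int,
    ptime unit_weights (fun y => enc_rats y.1 y.2) (fun y => enc_ints y.1 (Z y)) /\
    forall y, unit_weights y -> balances delta y.1 y.2 (Z y).
Proof.
move=> [_ [p [c [k H]]]].
have /choice [Z HZ] (y : nat * (nat -> rat)) : exists z : nat -> int, unit_weights y ->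
    (exists2 t, run p (enc_rats y.1 y.2) (enc_ints y.1 z) t &
      t <= c * dsize (enc_rats y.1 y.2) ^ k) /\ balances delta y.1 y.2 z.
  have [Hy|] := pselect (unit_weights y); last by exists (fun=> 0%R).
  case: y Hy => n a [n0 /= a01].
  have [|v [t [Hr Ht [v1 v2 v3]]]] := H n (\row_j a j)%R n0; first by move=> j; rewrite mxE a01.
  have E : enc_rVrat (\row_(j < n) a j)%R = enc_rats n a.
    by congr enc_seq; apply: map_enum_mkseq => j; rewrite mxE.
  rewrite E in Hr Ht; exists (of_ord 0%R (v ord0)) => _; split.
    exists t => //; suff -> : enc_ints n (of_ord 0%R (v ord0)) = enc_rVint v by [].
    by congr enc_seq; symmetry; apply: map_enum_mkseq => j; rewrite of_ordE.
  split=> [i lti||].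
  - by rewrite -[i]/(val (Ordinal lti)) of_ordE; exact: v1.
  - have [j nz] : exists j, (v ord0 j != 0)%R.
      by apply/existsP; apply: contra_neqT v2 => /existsPn v0; apply/rowP => j;
        rewrite mxE; apply/eqP/negbNE/v0.
    by exists j => //; rewrite of_ordE.
  - suff -> : (\sum_(j < n) (of_ord 0 (v ord0) j)%:~R * a j = dot v (\row_j a j))%R by [].
    by apply: eq_bigr => j _; rewrite of_ordE mxE.
exists Z; split; last by move=> y /HZ[].
exists p, (fun y => c * dsize (enc_rats y.1 y.2) ^ k); split; first by exists c, k.
by move=> y /HZ[].
Qed.

(** The bound concerns the value of the exponent, not its bit-size, since [2^m] has about [m]
    bits. *)
Lemma pt_pow2 X (P : X -> Prop) e m : ptime P e (fun x => Leaf (Posz (m x))) ->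
  pbound P e m -> ptime P e (fun x => Leaf (2 ^+ m x)%R).
Proof. by move=> Hm bm; apply: (pt_exp (a := fun=> 2%R)) => //; exact: pt_const. Qed.

(* The quantities of the algorithm are computable from [e x]; [e] varies since they
  are needed inside nested loops. *)
Record readable X (P : X -> Prop) (e : X -> data)
  (n : X -> nat) (A : X -> nat -> nat -> rat) (lam : X -> nat -> rat) (s : X -> nat) : Prop := {
  read_n : ptime P e (fun x => Leaf (Posz (n x)));
  read_A : ptime P e (fun x => enc_mx (n x) (A x));
  read_lam : ptime P e (fun x => enc_rats (n x) (lam x));
  read_s : ptime P e (fun x => Leaf (Posz (s x)));
  bound_s : pbound P e s;
  dim_gt0 : forall x, P x -> 0 < n x;
  A_01 : forall x i j, P x -> i < n x -> j < n x -> (0 <= A x i j <= 1)%R;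
  lambda_gt0 : forall x i, P x -> i < n x -> (0 < lam x i)%R }.

Lemma readable_below X P e n A lam s (m : X -> nat) : readable P e n A lam s ->
  readable (below P m) (ctx e) (fun y => n y.1) (fun y => A y.1) (fun y => lam y.1)
    (fun y => s y.1).
Proof.
case=> H1 H2 H3 H4 H5 H6 H7 H8; split.
- exact: (@pt_below _ _ _ m _ H1).
- exact: (@pt_below _ _ _ m _ H2).
- exact: (@pt_below _ _ _ m _ H3).
- exact: (@pt_below _ _ _ m _ H4).
- apply: (@pb_trans _ _ _ (fun y => e y.1)); first exact/ptime_pb/pt_proj1.
  by apply: (pb_reindex (h := fst) _ H5) => y [].
- by move=> y [/H6].
- by move=> y i j [Py _]; exact: H7.
- by move=> y i [Py _]; exact: H8.
Qed.

(** * Computing the packed instance in polynomial time *)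

Section Quantities.
Variables (X : Type) (P : X -> Prop) (e : X -> data).
Variables (n : X -> nat) (A : X -> nat -> nat -> rat) (lam : X -> nat -> rat) (s : X -> nat).
Hypothesis rd : readable P e n A lam s.

Lemma pb_n : pbound P e n.
Proof. by apply: pb_le (pb_length (read_lam rd)) => x _; rewrite size_mkseq. Qed.

Lemma pb_nbits : pbound P e (fun x => nbits (n x)).
Proof. exact: pb_mul (pb_const _ _ 4) pb_n. Qed.

Lemma pb_nitems : pbound P e (fun x => nitems (n x)).
Proof. exact: pb_mul pb_n pb_nbits. Qed.

Lemma pt_nbits : ptime P e (fun x => Leaf (Posz (nbits (n x)))).
Proof.
apply: (pt_ext _ (pt_mul (pt_const P e (Leaf 4%R)) (read_n rd))) => x _.
by rewrite /nbits PoszM.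
Qed.

Lemma pt_nitems : ptime P e (fun x => Leaf (Posz (nitems (n x)))).
Proof. by apply: (pt_ext _ (pt_mul (read_n rd) pt_nbits)) => x _; rewrite /nitems PoszM. Qed.

Lemma pt_lam i : (forall x, P x -> i x < n x) -> ptime P e (fun x => Leaf (Posz (i x))) ->
  ptime P e (fun x => enc_rat (lam x (i x))).
Proof.
move=> lti Hi; apply: (pt_ext _ (pt_nth (read_lam rd) _ Hi)) => x Px.
- by rewrite nth_mkseq ?lti.
- by rewrite size_mkseq lti.
Qed.

Lemma pt_A i j : (forall x, P x -> i x < n x) -> (forall x, P x -> j x < n x) ->
  ptime P e (fun x => Leaf (Posz (i x))) -> ptime P e (fun x => Leaf (Posz (j x))) ->
  ptime P e (fun x => enc_rat (A x (i x) (j x))).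
Proof.
move=> lti ltj Hi Hj.
have H : ptime P e (fun x => enc_rats (n x) (A x (i x))).
  apply: (pt_ext _ (pt_nth (read_A rd) _ Hi)) => x Px.
  - by rewrite nth_mkseq ?lti.
  - by rewrite size_mkseq lti.
apply: (pt_ext _ (pt_nth H _ Hj)) => x Px.
- by rewrite nth_mkseq ?ltj.
- by rewrite size_mkseq ltj.
Qed.

Lemma pt_row_bound i : (forall x, P x -> i x < n x) ->
  ptime P e (fun x => Leaf (Posz (i x))) ->
  ptime P e (fun x => Leaf (row_bound (n x) (lam x) (s x) (i x))).
Proof.
move=> lti Hi; have Hl := pt_lam lti Hi.
apply: pt_div; apply: pt_mul.
- exact: pt_pow2 pt_nbits pb_nbits.
- exact: pt_snd Hl.
- exact: pt_fst Hl.
- exact: pt_pow2 (read_s rd) (bound_s rd).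
Qed.

Section Item.
Variable k : X -> nat.
Hypothesis ltk : forall x, P x -> k x < nitems (n x).
Hypothesis Hk : ptime P e (fun x => Leaf (Posz (k x))).

Lemma item_col_lt x : P x -> k x %/ nbits (n x) < n x.
Proof. by move=> Px; rewrite ltn_divLR ?ltk // muln_gt0 (dim_gt0 rd). Qed.

Lemma pt_item_col : ptime P e (fun x => Leaf (Posz (k x %/ nbits (n x)))).
Proof. by apply: (pt_ext _ (pt_div Hk pt_nbits)) => x _; rewrite divz_nat. Qed.

(** The language has only quotients; the remainder is recovered by subtraction. *)
Lemma pt_item_bit : ptime P e (fun x => Leaf (Posz (k x %% nbits (n x)))).
Proof.
apply: (pt_ext _ (pt_sub Hk (pt_mul pt_item_col pt_nbits))) => x _; congr Leaf.
by rewrite {1}(divn_eq (k x) (nbits (n x))) PoszD PoszM addrC addKr.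
Qed.

Lemma pt_row_coef i : (forall x, P x -> i x < n x) ->
  ptime P e (fun x => Leaf (Posz (i x))) ->
  ptime P e (fun x => Leaf (row_coef (n x) (A x) (lam x) (s x) (i x) (k x))).
Proof.
move=> lti Hi; have Hl := pt_lam lti Hi; have Ha := pt_A lti item_col_lt Hi pt_item_col.
apply: pt_div; apply: pt_mul.
- apply: pt_pow2 pt_item_bit _; apply: pb_le pb_nbits => x Px.
  by rewrite ltnW // ltn_pmod // muln_gt0 (dim_gt0 rd).
- exact: pt_mul (pt_fst Ha) (pt_snd Hl).
- exact: pt_snd Ha.
- apply: pt_mul (pt_fst Hl) _; apply: pt_mul (read_n rd) _.
  exact: pt_pow2 (read_s rd) (bound_s rd).
Qed.

End Item.

End Quantities.

Section Instance.
Variables (X : Type) (P : X -> Prop) (e : X -> data).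
Variables (n : X -> nat) (A : X -> nat -> nat -> rat) (lam : X -> nat -> rat) (s : X -> nat).
Hypothesis rd : readable P e n A lam s.

Lemma pt_loop_bound : ptime (below P n) (ctx e)
  (fun y => Leaf (row_bound (n y.1) (lam y.1) (s y.1) y.2)).
Proof.
by apply: (pt_row_bound (readable_below n rd) (i := snd)) (pt_idx _ _) => y [].
Qed.

Lemma pt_total_modulus : ptime P e (fun x => Leaf (total_modulus (n x) (lam x) (s x))).
Proof.
apply: (pt_affine (a := fun x i => (row_bound (n x) (lam x) (s x) i + 1)%R)
  (b := fun _ _ => 0%R)
  (h := fun x i => modulus (row_bound (n x) (lam x) (s x)) i)) => //.
- exact: read_n rd.
- exact: pb_n rd.
- exact: (pt_const P e (Leaf 1%R)).
- exact: (pt_add pt_loop_bound (pt_const _ _ (Leaf 1%R))).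
- exact: pt_const.
Qed.

Lemma pt_slack : ptime P e (fun x => Leaf (slack (n x) (lam x) (s x))).
Proof.
apply: pt_mul pt_total_modulus _.
apply: (pt_ext _ (pt_mul (pt_const P e (Leaf 8%R)) (pt_nitems rd))) => x _.
by rewrite PoszM.
Qed.

Lemma pt_item_weight k : (forall x, P x -> k x < nitems (n x)) ->
  ptime P e (fun x => Leaf (Posz (k x))) ->
  ptime P e (fun x => Leaf (item_weight (n x) (A x) (lam x) (s x) (k x))).
Proof.
move=> ltk Hk.
apply: (pt_affine (a := fun x i => (row_bound (n x) (lam x) (s x) i + 1)%R)
  (b := fun x i => row_coef (n x) (A x) (lam x) (s x) i (k x))
  (h := fun x i => packed (row_bound (n x) (lam x) (s x))
     (row_coef (n x) (A x) (lam x) (s x)) (k x) i)) => //.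
- exact: read_n rd.
- exact: pb_n rd.
- exact: (pt_const P e (Leaf 0%R)).
- exact: (pt_add pt_loop_bound (pt_const _ _ (Leaf 1%R))).
- apply: (pt_row_coef (readable_below n rd) (k := fun y => k y.1) _ _
    (i := snd) _ (pt_idx _ _)).
  + by move=> y [Py _]; exact: ltk.
  + exact: pt_below Hk.
  + by move=> y [].
Qed.

Lemma pt_item k : (forall x, P x -> k x < nitems (n x)) ->
  ptime P e (fun x => Leaf (Posz (k x))) ->
  ptime P e (fun x => enc_rat (item (n x) (A x) (lam x) (s x) (k x))).
Proof.
move=> ltk Hk.
(* The fraction is already in lowest terms, so the computed pair is the encoding of the rational. *)
apply: (pt_ext (f := fun x => Node (Leaf (item_num (n x) (A x) (lam x) (s x) (k x)))
    (Leaf (item_den (n x) (lam x) (s x))))) => [x Px|].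
  have n0 := dim_gt0 rd Px.
  have a01 i j := @A_01 _ _ _ _ _ _ _ rd x i j Px.
  have l0 i := @lambda_gt0 _ _ _ _ _ _ _ rd x i Px.
  by rewrite /enc_rat (numq_item _ n0 a01 l0) (denq_item _ n0 a01 l0).
apply: pt_pair; last exact: pt_mul pt_total_modulus pt_slack.
apply: pt_add (pt_const _ _ (Leaf 1%R)).
exact: pt_mul (pt_item_weight ltk Hk) pt_slack.
Qed.

End Instance.

Lemma pt_items X (P : X -> Prop) e n A lam s : readable P e n A lam s ->
  ptime P e (fun x => enc_rats (nitems (n x)) (item (n x) (A x) (lam x) (s x))).
Proof.
move=> rd; apply: (pt_mkseq (pt_nitems rd) (pb_nitems rd)
  (f := fun x k => enc_rat (item (n x) (A x) (lam x) (s x) k))).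
by apply: (pt_item (readable_below _ rd) (k := snd)) (pt_idx _ _) => y [].
Qed.

(** * Oracle call, acceptance test and search for the scale *)

Section Solve.
Variables (Z : nat * (nat -> rat) -> nat -> int).
Hypothesis HZ : ptime unit_weights (fun y => enc_rats y.1 y.2) (fun y => enc_ints y.1 (Z y)).

Definition signs n A lam s := Z (nitems n, item n A lam s).

(** Its vanishing is the acceptance test; it replaces a comparison with [rho], which need not be
    computable. *)
Definition residue n A lam s : int :=
  (\sum_(k < nitems n) signs n A lam s k * item_weight n A lam s k)%R.

Lemma pt_signs X (P : X -> Prop) e n A lam s : readable P e n A lam s ->
  ptime P e (fun x => enc_ints (nitems (n x)) (signs (n x) (A x) (lam x) (s x))).
Proof.
move=> rd; apply: pt_trans (pt_items rd) _.
apply: (pt_reindex (h := fun x => (nitems (n x), item (n x) (A x) (lam x) (s x))) _ HZ).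
move=> x Px; have n0 := dim_gt0 rd Px; split; first by rewrite /= !muln_gt0 n0.
move=> k; apply: item_01 => // [i j|i] lti.
- exact: (A_01 rd Px lti).
- exact: (lambda_gt0 rd Px lti).
Qed.

Lemma pt_residue X (P : X -> Prop) e n A lam s : readable P e n A lam s ->
  ptime P e (fun x => Leaf (residue (n x) (A x) (lam x) (s x))).
Proof.
move=> rd; apply: (pt_sum (pt_nitems rd) (pb_nitems rd)
  (b := fun x k => (signs (n x) (A x) (lam x) (s x) k *
     item_weight (n x) (A x) (lam x) (s x) k)%R)).
have rd' := readable_below (fun x => nitems (n x)) rd.
apply: pt_mul; last first.
  by apply: (pt_item_weight rd' (k := snd)) (pt_idx _ _) => y [].
apply: (pt_ext _ (pt_nth (pt_signs rd') _ (pt_idx _ _))) => -[x k] [/= Px ltk].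
  by rewrite nth_mkseq.
by rewrite size_mkseq.
Qed.

Lemma pt_decode X (P : X -> Prop) e n A lam s : readable P e n A lam s ->
  ptime P e (fun x => enc_ints (n x) (decode (n x) (signs (n x) (A x) (lam x) (s x)))).
Proof.
move=> rd; apply: (pt_mkseq (read_n rd) (pb_n rd)
  (f := fun x j => Leaf (decode (n x) (signs (n x) (A x) (lam x) (s x)) j))).
have rd1 := readable_below n rd; set P1 := below P n in rd1 *.
apply: (pt_sum (m := fun y => nbits (n y.1)) (pt_nbits rd1) (pb_nbits rd1)
  (b := fun y l => (2 ^+ l *
     signs (n y.1) (A y.1) (lam y.1) (s y.1) (y.2 * nbits (n y.1) + l)%N)%R)).
(* The environment of the inner loop is [((x, j), l)], with column [j] and bit [l]. *)
have rd2 := readable_below (fun y => nbits (n y.1)) rd1.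
apply: pt_mul.
  apply: (pt_pow2 (m := snd)) (pt_idx _ _) _.
  apply: pb_le (pb_nbits rd2) => y [_ lt]; exact: ltnW lt.
apply: (pt_ext _ (pt_nth (i := fun w => w.1.2 * nbits (n w.1.1) + w.2) (pt_signs rd2) _ _)).
- move=> [[x j] l] [[/= Px ltj] ltl]; by rewrite nth_mkseq ?bit_index_lt.
- move=> [[x j] l] [[/= Px ltj] ltl]; by rewrite size_mkseq bit_index_lt.
- have Hj := @pt_below _ _ _ (fun y => nbits (n y.1)) _ (pt_idx e P1).
  apply: (pt_ext _ (pt_add (pt_mul Hj (pt_nbits rd2)) (pt_idx _ _))) => w _.
  by rewrite PoszD PoszM.
Qed.

End Solve.

Record instance := Instance {
  dim : nat; forms : nat -> nat -> rat; radii : nat -> rat }.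

Definition enc_instance x := Node (enc_mx (dim x) (forms x)) (enc_rats (dim x) (radii x)).

Definition valid x := [/\ 0 < dim x,
  forall i j, i < dim x -> j < dim x -> (0 <= forms x i j <= 1)%R,
  forall i, i < dim x -> (0 < radii x i <= 2 ^+ dim x)%R
  & (1 <= \prod_(i < dim x) radii x i)%R].

(** The dimension is recovered as the length of the list of radii. The scale 0 is a placeholder,
    replaced through [readable_scale]. *)
Lemma readable_instance : readable valid enc_instance dim forms radii (fun=> 0).
Proof.
have Hl : ptime valid enc_instance (fun x => enc_rats (dim x) (radii x)) by exact: pt_proj2.
split => //.
- by apply: (pt_ext _ (pt_size Hl)) => x _; rewrite size_mkseq.
- exact: pt_proj1.
- exact: pt_const.
- exact: pb_const.
- by move=> x [].
- by move=> x i j [_ H _ _]; exact: H.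
- by move=> x i [_ _ H _] /H /andP[].
Qed.

Lemma readable_scale X (P Q : X -> Prop) e e' n A lam s s' :
  (forall x, Q x -> P x) -> readable P e n A lam s -> ptime Q e' e ->
  ptime Q e' (fun x => Leaf (Posz (s' x))) -> pbound Q e' s' ->
  readable Q e' n A lam s'.
Proof.
move=> QP [H1 H2 H3 H4 H5 H6 H7 H8] He Hs Hb.
have L f : ptime P e f -> ptime Q e' f.
  by move=> H; apply: pt_trans He _; exact: (pt_reindex (h := id) QP H).
split => //; try exact: L.
- by move=> x /QP /H6.
- by move=> x i j /QP; exact: H7.
- by move=> x i /QP; exact: H8.
Qed.

Section Search.
Variables (Z : nat * (nat -> rat) -> nat -> int).
Hypothesis HZ : ptime unit_weights (fun y => enc_rats y.1 y.2) (fun y => enc_ints y.1 (Z y)).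

Definition accepts x s := residue Z (dim x) (forms x) (radii x) s == 0%R.
(** Chosen so that [(2^(2 n + 2))^n = 4^n * 2^(2 n^2)], where [2^(2 n^2)] is the assumed bound on
    [rho (4 n^2)]. *)
Definition max_scale n := 2 * n + 2.
(** The least accepted guess, or [max_scale + 1] if there is none. *)
Definition scale x := find (accepts x) (iota 0 (max_scale (dim x)).+1).
Definition solution x := decode (dim x) (signs Z (dim x) (forms x) (radii x) (scale x)).

Lemma accepts_scale x : scale x <= max_scale (dim x) -> accepts x (scale x).
Proof.
move=> le; have H : has (accepts x) (iota 0 (max_scale (dim x)).+1).
  by rewrite has_find size_iota ltnS.
by have := nth_find 0 H; rewrite -/(scale x) nth_iota ?add0n.
Qed.

Lemma rejects_below x s : s < scale x -> s <= max_scale (dim x) -> ~~ accepts x s.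
Proof. by move=> /(before_find 0) H le; move: H; rewrite nth_iota ?add0n // => ->. Qed.

Hypothesis scale_le : forall x, valid x -> scale x <= max_scale (dim x).

Lemma pt_solution : ptime valid enc_instance (fun x => enc_ints (dim x) (solution x)).
Proof.
have bs : pbound valid enc_instance scale.
  apply: (pb_le (g := fun x => 2 * dim x + 2)) => [x /scale_le //|].
  apply: pb_add (pb_const _ _ 2); apply: pb_mul (pb_const _ _ 2) _.
  exact: pb_n readable_instance.
have Hs : ptime valid enc_instance (fun x => Leaf (Posz (scale x))).
  (* A nonzero residue is a true guard, so the search goes on exactly while the guess is
     rejected. *)
  apply: (pt_min (b := fun y => Leaf (residue Z (dim y.1) (forms y.1) (radii y.1) y.2))) => //.
    move=> x i vx lei; have le := scale_le vx; have [lti|] := ltnP i (scale x).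
      exact: rejects_below lti (leq_trans lei le).
    by move=> gei; have /eqP -> : i == scale x by [rewrite eqn_leq lei];
      have := accepts_scale le; rewrite /accepts => /eqP /= ->.
  have rd : readable (fun y => valid y.1 /\ y.2 <= scale y.1) (fun y => enc_instance y.1)
      (fun y => dim y.1) (fun y => forms y.1) (fun y => radii y.1) (fun=> 0).
    case: readable_instance => H1 H2 H3 H4 H5 H6 H7 H8; split.
    + by apply: (pt_reindex (h := fst) _ H1) => y [].
    + by apply: (pt_reindex (h := fst) _ H2) => y [].
    + by apply: (pt_reindex (h := fst) _ H3) => y [].
    + exact: pt_const.
    + exact: pb_const.
    + by move=> y [/H6].
    + by move=> y i j [Py _]; exact: H7.
    + by move=> y i [Py _]; exact: H8.
  apply: (pt_residue HZ (s := snd)).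
  apply: (readable_scale (s' := snd) _ rd) (pt_idx _ _) _ => //; first exact: pt_proj1.
  apply: (pb_le (g := fun y => scale y.1)) => [y []//|].
  apply: (@pb_trans _ _ _ (fun y => enc_instance y.1)); first exact/ptime_pb/pt_proj1.
  by apply: (pb_reindex (h := fst) _ bs) => y [].
apply: (pt_decode HZ (s := scale)).
exact: (readable_scale _ readable_instance (pt_refl _ _) Hs bs).
Qed.

End Search.

(** * Correctness *)

Local Open Scope ring_scope.

(* The instance [a_k = 2^k / 2^n], on which every nonzero sign vector has a value
  of at least [1 / 2^n]. *)
Lemma rho_ge1 (R : realType) (rho : nat -> R) :
  number_balancing_approximation (fun n => rho n / 2 ^+ n) ->
  forall n, (0 < n)%N -> 1 <= rho n.
Proof.
move=> /oracle_function [Z [_ HZ]] n n0.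
pose a k : rat := 2 ^+ k / 2 ^+ n.
have p0 : 0 < 2 ^+ n :> rat by rewrite exprn_gt0.
have [|Zs Z0 Zr] := HZ (n, a).
  split=> // k /= ltk; rewrite divr_ge0 ?exprn_ge0 //= ler_pdivrMr // mul1r.
  by rewrite ler_weXn2l // ltnW.
have S0 := binary_neq0 Zs Z0; set S := \sum_(l < _) _ in S0.
have E : \sum_(k < n) (Z (n, a) k)%:~R * a k = S%:~R / 2 ^+ n.
  rewrite /S rmorph_sum mulr_suml; apply: eq_bigr => k _.
  by rewrite /a rmorphM rmorphXn /= mulrA (mulrC (_%:~R)).
move: Zr; rewrite /= E fmorph_div rmorphXn /= !ratr_nat ratr_int normrM normfV.
have q0 : 0 < 2 ^+ n :> R by rewrite exprn_gt0.
rewrite (gtr0_norm q0) ler_pM2r ?invr_gt0 //; apply: le_trans.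
by rewrite -intr_norm ler1z -gtz0_ge1 normr_gt0.
Qed.

(* The lower bound on [r] makes the least such [s] positive, so that minimality
  can be applied to [s - 1]. *)
Lemma scale_exists (R : realType) (n : nat) (r : R) : (0 < n)%N ->
  1 <= r -> r <= 2 ^+ (2 * n ^ 2) ->
  exists s, [/\ (s <= max_scale n)%N, 4 ^+ n * r <= (2 ^+ s) ^+ n
    & 2 ^+ s <= 8 * r `^ n%:R^-1].
Proof.
move=> n0 r1 le_r.
have top : 4 ^+ n * r <= (2 ^+ max_scale n) ^+ n.
  apply: le_trans (ler_wpM2l _ le_r) _; first exact: exprn_ge0.
  have -> : 4 = 2 ^+ 2 :> R by rewrite -natrX.
  by rewrite -!exprM -exprD ler_weXn2l ?ler1n // /max_scale; nia.
have ex : exists s, 4 ^+ n * r <= (2 ^+ s) ^+ n by exists (max_scale n).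
case: (ex_minnP ex) => s Hs min_s; exists s; split=> //; first exact: min_s.
case: s Hs min_s => [|s] Hs min_s.
  have : 4 <= 4 ^+ n * r.
    rewrite -[leLHS]mulr1 ler_pM // -[leLHS]expr1 ler_weXn2l ?ler1n //.
  by move=> /le_trans /(_ Hs); rewrite expr0 expr1n (ler_nat _ 4 1).
(* Here [s] is one less than the least exponent. Taking [n]-th roots gives [2^s / 4 <= r^(1/n)], and
   doubling [2^s] yields the constant 8. *)
have lt_s : (2 ^+ s) ^+ n < 4 ^+ n * r by rewrite ltNge; apply/negP => /min_s; rewrite ltnn.
have x0 : 0 <= 2 ^+ s / 4 :> R by rewrite divr_ge0 ?exprn_ge0.
have lt_x : (2 ^+ s / 4) ^+ n <= r.
  by rewrite expr_div_n ler_pdivrMr ?exprn_gt0 // mulrC ltW.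
have : 2 ^+ s / 4 <= r `^ n%:R^-1.
  have -> : 2 ^+ s / 4 = ((2 ^+ s / 4) ^+ n) `^ n%:R^-1 :> R.
    rewrite -(powR_mulrn n x0) -powRrM mulfV ?powRr1 // pnatr_eq0 -lt0n //.
  by apply: ge0_ler_powR; rewrite ?nnegrE ?invr_ge0 ?ler0n ?exprn_ge0 // (le_trans ler01).
rewrite exprS; lra.
Qed.

(** Read [v = n], [l = lam i], [p = 2^s] and [w = rho(N)^(1/n)]: the left side is then [mu i * N],
    and [p <= 8 w] turns [4 n^3] into [32 n^3], at most [32 n^4]. *)
Lemma error_bound (R : realFieldType) (v l p w : R) : 1 <= v -> 0 <= l -> 0 <= w ->
  p <= 8 * w -> l * (v * p) * (v * (4 * v)) <= 32 * v ^+ 4 * l * w.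
Proof.
move=> v1 l0 w0 le_p; have v0 : 0 <= v by exact: le_trans v1.
apply: (@le_trans _ _ (4 * v ^+ 3 * l * (8 * w))).
  have -> : l * (v * p) * (v * (4 * v)) = 4 * v ^+ 3 * l * p by ring.
  by apply: (ler_wpM2l _ le_p); rewrite !mulr_ge0 ?exprn_ge0.
have -> : 4 * v ^+ 3 * l * (8 * w) = 32 * v ^+ 3 * (l * w) by ring.
rewrite -(mulrA (32 * v ^+ 4)); apply: ler_wpM2r; first exact: mulr_ge0.
apply: ler_wpM2l => //; rewrite [leRHS]exprS -[leLHS]mul1r.
by apply: ler_wpM2r => //; exact: exprn_ge0.
Qed.

(** * The accepted scale and the error of the solution *)

Section Correctness.
Variables (R : realType) (rho : nat -> R) (Z : nat * (nat -> rat) -> nat -> int).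
Hypothesis rho_ge : forall n, (0 < n)%N -> 1 <= rho n.
Hypothesis rho_le : forall n : nat, (2 <= n)%N -> rho n <= 2 `^ (n%:R / 2).
Hypothesis HZ : forall y, unit_weights y ->
  balances (fun n => rho n / 2 ^+ n) y.1 y.2 (Z y).
Variable x : instance.
Hypothesis vx : valid x.

Let n := dim x.
Let N := nitems n.

Let n0 : (0 < n)%N. Proof. by case: vx. Qed.
Let A01 i j : (i < n)%N -> (j < n)%N -> 0 <= forms x i j <= 1.
Proof. by case: vx => _ H _ _; exact: H. Qed.
Let radii0 i : (i < n)%N -> 0 < radii x i.
Proof. by case: vx => _ _ H _ /H /andP[]. Qed.

Lemma signs_balance s :
  balances (fun n => rho n / 2 ^+ n) N (item n (forms x) (radii x) s)
    (signs Z n (forms x) (radii x) s).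
Proof.
apply: (HZ (y := (N, item n (forms x) (radii x) s))); split.
  by rewrite /= !muln_gt0 n0.
by move=> k; exact: item_01.
Qed.

(** Rejection would make the scaled value exceed 3/4, whereas the oracle and [total_modulus_le]
    bound it by [(3/4)^n], which is at most 3/4 because [n >= 1]. *)
Lemma accepts_large s : (s <= max_scale n)%N ->
  4 ^+ n * rho N <= (2 ^+ s) ^+ n -> accepts Z x s.
Proof.
move=> le_s Hs; apply/negP => /negP rej.
have [Zs _ Zr] := signs_balance s.
have := rejected n0 A01 radii0 Zs rej.
set D := total_modulus n _ s; set B := \sum_(k < _) _ in Zr *.
rewrite -(ltr_rat R) fmorph_div [X in _ < X]rmorphM /= ratr_int ratr_norm !ratr_nat.
apply/negP; rewrite -leNgt.
have D0 : 0 <= D%:~R :> R by rewrite ler0z ltW //; exact: (total_modulus_gt0 _ n0 A01 radii0).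
apply: le_trans (ler_wpM2l D0 Zr) _.
have : (ratr (D%:~R * (2 ^+ s) ^+ n) : R) <= ratr (3 ^+ n * 2 ^+ N).
  rewrite ler_rat; apply: (total_modulus_le n0 A01 radii0) => [i lti|]; last by case: vx.
  have le_r : radii x i <= 2 ^+ n by case: vx => _ _ H _; case/andP: (H i lti).
  apply: le_trans (ler_wpM2r _ le_r) _; first exact: exprn_ge0.
  rewrite -exprD -exprS ler_weXn2l ?ler1n // /nbits.
  by move: le_s n0; rewrite /max_scale; lia.
rewrite !rmorphM !rmorphXn /= ratr_int !ratr_nat => le_D.
have p0 : 0 < 2 ^+ N :> R by rewrite exprn_gt0.
have q0 : 0 < 4 ^+ n :> R by rewrite exprn_gt0.
rewrite mulrA ler_pdivrMr //.
have : 4 ^+ n * (D%:~R * rho N) <= 3 ^+ n * 2 ^+ N.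
  by apply: le_trans le_D; rewrite mulrCA ler_wpM2l.
have : 3 ^+ n <= 3 / 4 * 4 ^+ n :> R.
  have : 3 ^+ n.-1 <= 4 ^+ n.-1 :> R by rewrite lerXn2r ?nnegrE // ler_nat.
  by rewrite -(prednK n0) !exprS; lra.
move=> h3 h4; rewrite -(ler_pM2l q0); apply: le_trans h4 _.
apply: le_trans (ler_wpM2r (ltW p0) h3) _.
by rewrite le_eqVlt; apply/orP; left; apply/eqP; ring.
Qed.

(** The least accepted guess is at most any guess that must be accepted. The growth condition
    applies as [N = 4 n^2 >= 2], with exponent [N / 2 = 2 n^2]. *)
Lemma scale_bound : (scale Z x <= max_scale n)%N /\ 2 ^+ scale Z x <= 8 * rho N `^ n%:R^-1.
Proof.
have N2 : (2 <= N)%N by rewrite /N /nitems /nbits; move: n0; nia.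
have rN : rho N <= 2 ^+ (2 * n ^ 2).
  apply: le_trans (rho_le N2) _; rewrite -powR_mulrn //.
  have -> // : N%:R / 2 = (2 * n ^ 2)%:R :> R.
  have -> : N = (2 * n ^ 2 * 2)%N by rewrite /N /nitems /nbits; nia.
  by rewrite natrM mulfK ?pnatr_eq0.
have [s [le_s Hs bs]] := scale_exists n0 (rho_ge (ltnW N2)) rN.
have acc := accepts_large le_s Hs.
have le : (scale Z x <= s)%N.
  rewrite leqNgt; apply/negP => lt.
  by have := rejects_below lt le_s; rewrite acc.
split; first exact: leq_trans le le_s.
by apply: le_trans bs; rewrite ler_weXn2l ?ler1n.
Qed.

(** Acceptance makes the packed sum vanish; unpacking gives one vanishing sum per row, so row [i]
    has error at most [mu i * N], and [scale_bound] limits [mu i]. *)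
Lemma solution_correct :
  (exists2 j, (j < n)%N & solution Z x j != 0) /\
  forall i, (i < n)%N ->
    `|ratr (\sum_(j < n) (solution Z x j)%:~R * forms x i j)| <=
      32 * n%:R ^+ 4 * ratr (radii x i) * rho N `^ n%:R^-1.
Proof.
have [le_s bs] := scale_bound.
have [Zs Znz _] := signs_balance (scale Z x).
split; first exact: decode_neq0.
move=> i lti.
have acc := accepts_scale le_s.
have E := unpack (row_coef_ge0 _ n0 A01 radii0) (sum_row_coef _ n0 A01 radii0) Zs (eqP acc) lti.
have := decode_error n0 A01 radii0 Zs lti E.
rewrite -(ler_rat R) ratr_norm => /le_trans; apply.
rewrite !rmorphM rmorphXn /= !ratr_nat.
have l0 : 0 <= ratr (radii x i) :> R by rewrite ler0q ltW ?radii0.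
have w0 : 0 <= rho N `^ n%:R^-1 by rewrite powR_ge0.
have n1 : 1 <= n%:R :> R by rewrite ler1n.
by rewrite /nbits natrM; exact: error_bound.
Qed.

End Correctness.

Theorem theorem9 (R : realType) :
  exists C : R, 0 < C /\
  forall rho : nat -> R,
    (forall n : nat, (2 <= n)%N -> rho n <= 2 `^ (n%:R / 2)) ->
    number_balancing_approximation (fun n => rho n / 2 ^+ n) ->
    poly_time_solvable
      (fun n (inst : 'M[rat]_n * 'rV[rat]_n) =>
        Node (enc_mxrat inst.1) (enc_rVrat inst.2))
      enc_rVint
      (fun n (inst : 'M[rat]_n * 'rV[rat]_n) =>
        let: (A, lambda) := inst in
        [/\ forall i j, 0 <= A i j <= 1,
            forall i, 0 < lambda ord0 i <= 2 ^+ n,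
            forall i j : 'I_n, (i <= j)%N -> lambda ord0 i <= lambda ord0 j
          & 1 <= \prod_(i < n) lambda ord0 i])
      (fun n (inst : 'M[rat]_n * 'rV[rat]_n) (x : 'rV[int]_n) =>
        let: (A, lambda) := inst in
        x != 0 /\
        forall i : 'I_n,
          `|ratr (dot x (row i A))|
            <= C * n%:R ^+ 4 * ratr (lambda ord0 i)
               * rho (4 * n ^ 2)%N `^ (n%:R^-1)).
Proof.
(* The constant is [8 * 4]: 8 from the bound on the scale and 4 from [N = 4 n^2]. *)
exists 32; split=> // rho rho_le app.
have rho_ge := rho_ge1 app; have [Z [ptZ HZ]] := oracle_function app.
have correct x (vx : valid x) := solution_correct rho_ge rho_le HZ vx.
have scale_le x (vx : valid x) := (scale_bound rho_ge rho_le HZ vx).1.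
have [p [T [[c [k HT]] Hp]]] := pt_solution ptZ scale_le.
exists p, c, k => n [A lambda] n0 [A01 lambda01 _ prod_ge1].
pose x := Instance n (fun i j => of_ord 0 (fun i' => of_ord 0 (A i') j) i)
  (of_ord 0 (lambda ord0)).
have formsE (i j : 'I_n) : forms x i j = A i j by rewrite /= !of_ordE.
have radiiE (i : 'I_n) : radii x i = lambda ord0 i by rewrite /= of_ordE.
have vx : valid x.
  split=> //.
  - by move=> i j lti ltj; rewrite (formsE (Ordinal lti) (Ordinal ltj)).
  - by move=> i lti; rewrite (radiiE (Ordinal lti)).
  - by rewrite (eq_bigr _ (fun i _ => radiiE i)).
(* Both encodings are the same tree, so the run on [x] is a run on the given input. *)
have xE : enc_instance x = Node (enc_mxrat A) (enc_rVrat lambda).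
  congr Node; symmetry; congr enc_seq; apply: map_enum_mkseq => i; last by rewrite radiiE.
  by congr enc_seq; apply: map_enum_mkseq => j; rewrite mxE formsE.
have [t run_t le_t] := Hp x vx.
have [[j ltj nz] err] := correct x vx.
exists (\row_j solution Z x j), t; rewrite -xE; split.
- suff -> : enc_rVint (\row_(j0 < n) solution Z x j0) = enc_ints n (solution Z x) by [].
  by congr enc_seq; apply: map_enum_mkseq => i; rewrite mxE.
- exact: (leq_trans le_t (HT x vx)).
- split; first by apply: contra_neq nz => /rowP /(_ (Ordinal ltj)); rewrite !mxE.
  move=> i; have := err i (ltn_ord i); rewrite radiiE.
  have -> : nitems (dim x) = (4 * n ^ 2)%N by rewrite /nitems /nbits /=; lia.
  have -> // : dot (\row_j0 solution Z x j0) (row i A) =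
    \sum_(j0 < n) (solution Z x j0)%:~R * forms x i j0.
  by apply: eq_bigr => j0 _; rewrite !mxE formsE.
Qed.
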